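(* Let $\Omega$ be a star graph with outer paths $\Omega_1,\ldots,\Omega_N$ $(N\ge2)$ of thickness $\rho_1,\ldots,\rho_N$, put $R_i=\frac{\sum_{k\ne i}\rho_k}{\rho_i}$, and assume, for the index $i\in\{1,\dots,N\}$ under consideration, that $$F(1)+(R_i^2-1)F(a)<0.$$ Let $\Omega'$ be a graph obtained by replacing the center point $\mathrm P$ of $\Omega$ by a bounded finite graph $D$, and let $\mathcal P'(i,j)$ be the propagation index for $\Omega'$. Then $\mathcal P'(i,j)=0$ for any $j\ne i$ if the total length of the edges of $D$ is sufficiently small.
   Context: Metric graphs: a metric graph is a connected graph each of whose edges $E$ is identified with an interval $[0,L_E]$ (finite length $L_E>0$) or $[0,\infty)$ (infinite length); directions of edges only serve to fix coordinates. Multiple edges, loops and vertices of degree $1$ are allowed. Each edge $E$ has a constant thickness $\rho_E>0$; thicknesses of different edges may be unequal. At a vertex $V$ with incident edges $E_1,\ldots,E_m$ (a loop is counted twice), $\frac{\partial u}{\partial\nu_k}(V)$ denotes the derivative of $u$ at $V$ along $E_k$ in the direction pointing from $V$ into the interior of $E_k$; the Kirchhoff condition at $V$ is $\sum_{k=1}^m\rho_{E_k}\frac{\partial u}{\partial\nu_k}(V)=0$. Star graph: $N$ half lines $\Omega_1,\dots,\Omega_N$ (outer paths), with coordinates $x_i\in[0,\infty)$, whose endpoints $x_i=0$ are identified with a single vertex $\mathrm P$. Replacing $\mathrm P$ by a bounded finite metric graph $D$ (finitely many edges of finite length) gives $\Omega'=D\cup\Omega_1'\cup\cdots\cup\Omega_N'$,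 where $\Omega_i'$ is a half line with coordinate $x_i\in[0,\infty)$ and the same thickness $\rho_i$ as $\Omega_i$, with $D\cap\Omega_i'=\{\mathrm P_i\}$, where $\mathrm P_i$ (corresponding to $x_i=0$) is a vertex of $D$; the $\mathrm P_i$ are not necessarily distinct. Nonlinearity: $f\in C^1$ and for some $0<a<1$: $f(0)=f(a)=f(1)=0$, $f<0$ on $(0,a)$, $f>0$ on $(a,1)$, $f'(0)<0$, $f'(a)>0$, $f'(1)<0$, $\int_0^1f(s)\,ds>0$. $F(s)=\int_0^sf(r)\,dr$. Solution of $\partial_tu=\Delta_{\Omega'}u+f(u)$ on a time interval: a function $u(t,x)$ continuous in $(t,x)$ that satisfies $\partial_tu=\partial_x^2u+f(u)$ on each edge except at endpoints, with $\partial_xu$ continuous on each edge up to the endpoints, and the Kirchhoff condition at every vertex. Traveling wave: $(\phi,c)$, $c>0$, is the unique pair with $\phi''+c\phi'+f(\phi)=0$ and $0<\phi<1$ on $\mathbb R$, $\phi(-\infty)=1$, $\phi(+\infty)=0$, $\phi(0)=a$. Front-like solution and limit profile on $\Omega'$: for each $i$ there is a unique entire solution $\widehat u_i$ (defined for all $t\in\mathbb R$) with $0<\widehat u_i<1$ and $\lim_{t\to-\infty}\big(\sup_{x_i\in\Omega_i'}|\widehat u_i|_{\Omega_i'}(t,x_i)-\phi(-x_i-ct)|+\sup_{\Omega'\setminus\Omega_i'}|\widehat u_i(t,\cdot)|\big)=0$; it is strictly increasing in $t$. The limit profile is $\widehat v_i(x)=\lim_{t\to\infty}\widehat u_i(t,x)$.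 Propagation index: for $i\ne j$, $\lim_{x_j\to\infty}\widehat v_i|_{\Omega_j'}(x_j)$ exists and equals $1$ or $0$; $\mathcal P'(i,j)$ is this value ($1$: propagation; $0$: blocking).
   Formalization: The smallness threshold for the total length of D may depend on a positive lower bound for the thicknesses of the edges of D; a threshold uniform over all thicknesses is false, since a very thin edge of D can effectively cut off an outer path. *)

(* Defs.v *)
From HB Require Import structures.
From mathcomp Require Import all_boot all_order all_algebra.
From mathcomp Require Import all_classical all_reals all_analysis.

Set Implicit Arguments.
Unset Strict Implicit.
Unset Printing Implicit Defensive.

Import Order.TTheory GRing.Theory Num.Theory.
Import numFieldNormedType.Exports.

Local Open Scope ring_scope.
Local Open Scope classical_set_scope.

Definition adjacent (V E : finType) (src tgt : E -> V) : rel V :=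
  fun v w => [exists e, ((src e == v) && (tgt e == w))
                     || ((src e == w) && (tgt e == v))].

(* An edge [e] is the interval [0, elen e]: [src e] is the vertex at coordinate
   0 and [tgt e] the one at coordinate [elen e].  Loops and multiple edges are
   allowed. *)
Record bounded_graph (R : realType) := BoundedGraph {
  vertex : finType;
  edge : finType;
  src : edge -> vertex;
  tgt : edge -> vertex;
  elen : edge -> R;
  ethick : edge -> R;
  elen_gt0 : forall e, 0 < elen e;
  ethick_gt0 : forall e, 0 < ethick e;
  graph_connected : forall v w, connect (adjacent src tgt) v w
}.

Definition total_length (R : realType) (D : bounded_graph R) : R :=
  \sum_(e : edge D) elen e.

(* Every finite metric graph is a bounded one with half lines [0, +oo[ attached
   at vertices: [base r] is the vertex at coordinate 0 of the half line [r].
   Several half lines may share a base point. *)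
Record metric_graph (R : realType) := MetricGraph {
  core : bounded_graph R;
  ray : finType;
  base : ray -> vertex core;
  rthick : ray -> R;
  rthick_gt0 : forall r, 0 < rthick r
}.

(* A star graph is determined by the thicknesses of its outer paths. *)
Record star_graph (R : realType) := StarGraph {
  npaths : nat;
  pthick : 'I_npaths -> R;
  pthick_gt0 : forall k, 0 < pthick k
}.

Definition thickness_ratio (R : realType) (S : star_graph R)
    (i : 'I_(npaths S)) : R :=
  (\sum_(k | k != i) pthick k) / pthick i.

Definition replace_center (R : realType) (S : star_graph R)
    (D : bounded_graph R) (P : 'I_(npaths S) -> vertex D) : metric_graph R :=
  MetricGraph P (@pthick_gt0 R S).

Section Functions.
Variables (R : realType) (G : metric_graph R).

Definition branch : finType := (edge (core G) + ray G)%type.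

Definition dom (b : branch) : set R :=
  match b with
  | inl e => [set x | 0 <= x <= elen e]
  | inr _ => [set x | 0 <= x]
  end.

Definition interior_dom (b : branch) : set R :=
  match b with
  | inl e => [set x | 0 < x < elen e]
  | inr _ => [set x | 0 < x]
  end.

(* A function on the graph is a family of functions of the coordinate, one for
   each branch; only the values on [dom b] matter.  It is well defined on the
   graph when the values at the ends of the branches meeting at a vertex agree. *)
Definition agree_at_vertices (g : branch -> R -> R) :=
  exists gV : vertex (core G) -> R,
    [/\ forall e, g (inl e) 0 = gV (src e),
        forall e, g (inl e) (elen e) = gV (tgt e)
      & forall r, g (inr r) 0 = gV (base r)].

(* The derivative along [D]; one-sided at the endpoints of an interval. *)
Definition is_derive_within (D : set R) (g dg : R -> R) :=
  forall x, D x -> (g y - g x) / (y - x) @[y --> within D x^'] --> dg x.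

(* [dg b] is the derivative in the coordinate of the branch [b], hence the sign
   at the far end of an edge.  A loop contributes to both of the first sums. *)
Definition kirchhoff (dg : branch -> R -> R) :=
  forall v : vertex (core G),
    \sum_(e | src e == v) ethick e * dg (inl e) 0
    - \sum_(e | tgt e == v) ethick e * dg (inl e) (elen e)
    + \sum_(r | base r == v) rthick r * dg (inr r) 0 = 0.

(* Solutions of u_t = u_xx + f(u) defined for all times. *)
Definition entire_solution (f : R -> R) (u : R -> branch -> R -> R) :=
  exists ux : R -> branch -> R -> R,
  [/\ forall b, {within [set p : R * R | dom b p.2],
                   continuous (fun p : R * R => u p.1 b p.2)},
      forall t, agree_at_vertices (u t),
      forall t b, is_derive_within (dom b) (u t b) (ux t b)
                  /\ {within dom b, continuous (ux t b)},
      forall t b x, interior_dom b x ->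
        [/\ derivable (fun s => u s b x) t 1, derivable (ux t b) x 1
          & derive1 (fun s => u s b x) t = derive1 (ux t b) x + f (u t b x)]
    & forall t, kirchhoff (ux t)].

(* The second supremum runs over the branches other than the half line [i].
   The base point of [i] may be an end of such a branch; including it does not
   change the supremum of a continuous function. *)
Definition front_like_solution (f phi : R -> R) (c : R) (i : ray G)
    (u : R -> branch -> R -> R) :=
  [/\ entire_solution f u,
      forall t b x, dom b x -> 0 < u t b x < 1
    & sup [set `|u t (inr i) x - phi (- x - c * t)| | x in dom (inr i)]
      + sup [set z | exists b x, [/\ b != inr i, dom b x & z = `|u t b x|]]
      @[t --> -oo] --> (0 : R)].

Definition limit_profile (u : R -> branch -> R -> R) (v : branch -> R -> R) :=
  forall b x, dom b x -> u t b x @[t --> +oo] --> v b x.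

(* For the limit profile [v] of the front-like solution coming from the half
   line i, the propagation index from i to [j] is [p]. *)
Definition propagation_index_is (v : branch -> R -> R) (j : ray G) (p : R) :=
  v (inr j) x @[x --> +oo] --> p.

End Functions.

(* Meant for [0 <= s] only: the interval is empty for [s < 0]. *)
Definition primitive (R : realType) (f : R -> R) (s : R) : R :=
  \int[@lebesgue_measure R]_(x in `[0, s]) f x.

Definition bistable (R : realType) (f : R -> R) (a : R) :=
  [/\ (forall x, derivable f x 1) /\ continuous (derive1 f),
      0 < a < 1,
      [/\ f 0 = 0, f a = 0 & f 1 = 0],
      (forall s, 0 < s < a -> f s < 0) /\ (forall s, a < s < 1 -> 0 < f s)
    & [/\ derive1 f 0 < 0, 0 < derive1 f a, derive1 f 1 < 0 & 0 < primitive f 1]].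

Definition traveling_wave (R : realType) (f : R -> R) (a : R)
    (phi : R -> R) (c : R) :=
  [/\ 0 < c,
      forall x, derivable phi x 1 /\ derivable (derive1 phi) x 1,
      forall x, derive1 (derive1 phi) x + c * derive1 phi x + f (phi x) = 0,
      forall x, 0 < phi x < 1
    & [/\ phi x @[x --> -oo] --> (1 : R), phi x @[x --> +oo] --> (0 : R)
        & phi 0 = a]].

(* Main.v *)
Require Import Defs.
From HB Require Import structures.
From mathcomp Require Import all_boot all_order all_algebra.
From mathcomp Require Import all_classical all_reals all_analysis.
From mathcomp Require Import ring lra.

Set Implicit Arguments.
Unset Strict Implicit.
Unset Printing Implicit Defensive.

Import Order.TTheory GRing.Theory Num.Theory.
Import numFieldNormedType.Exports.

Local Open Scope ring_scope.
Local Open Scope classical_set_scope.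

(** The proof compares the front-like solution u with a stationary strict
    supersolution w that is small far out on every half line other than i.

    Let F' = f and F(0) = 0.  On the star graph itself, glue at the centre, at
    some height p slightly below a, the following profiles.  On the half line i
    take a profile rising from p that solves w'' + f(w) = 0 with energy
    w'^2 / 2 + F(w) = F(1) + th until it passes the value 1 with positive slope;
    it leaves the centre with slope A = sqrt(2 (F(1) + th - F(p))).  On the other
    half lines take a profile falling from p to a small level eta; it
    leaves the centre with slope at most - B, where B is close to
    sqrt(- 2 F(p)).  The Kirchhoff sum at the centre is negative as soon as
    A < R_i B, and for th and eta small and p close to a this is what the
    hypothesis F(1) + (R_i^2 - 1) F(a) < 0 gives ([blocking_margin]).  So w is
    a strict supersolution there.

    When the centre is replaced by a small graph D, w is taken affine on every
    edge of D, i.e. it is an electric potential with conductances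
    thickness / length, whose sources at the vertices absorb the slopes of the
    profiles and spread the strictly negative surplus over all the vertices.  The
    flux through any edge is bounded by the sources, hence the slopes are bounded
    by sources / rmin and the potential oscillates by at most a multiple of the
    total length of D ([small_core_potential]).  If D is short, the values of w
    on D stay between 0 and a, where f < 0, so that affine functions are
    supersolutions ([blocking_supersolution]).

    As t tends to - oo, u becomes smaller than eta on every bounded part of the
    half line i and on the rest of the graph, whereas w is at least eta
    everywhere and at least 1 > u far out on the half line i.  Hence u <= w at
    some time, and from then on by the comparison principle ([comparison]).
    The limit profile therefore lies below w, so its upper limit at infinity on
    a half line j <> i is at most a multiple of eta, while th and the length
    condition on D do not depend on eta. *)

(** * Antiderivatives *)

Lemma is_derive_continuous (R : realType) (F : R -> R) (x d : R) :
  is_derive x 1 F d -> {for x, continuous F}.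
Proof.
by move=> dF; apply: differentiable_continuous; apply/derivable1_diffP.
Qed.

(** The mean value inequality in the form used to compare two antiderivatives:
    the derivatives need only be ordered in the open interval. *)
Lemma increment_le (R : realType) (F G dF dG : R -> R) (x y : R) : x <= y ->
  (forall z, x <= z <= y -> is_derive z 1 F (dF z)) ->
  (forall z, x <= z <= y -> is_derive z 1 G (dG z)) ->
  (forall z, x < z < y -> dF z <= dG z) -> F y - F x <= G y - G x.
Proof.
rewrite le_eqVlt => /predU1P[->|xy] HF HG Hle; first by rewrite !subrr.
have D z : x <= z <= y -> is_derive z 1 (fun w => G w - F w) (dG z - dF z).
  by move=> z_xy; have := HF z z_xy; have := HG z z_xy => ? ?; exact: is_deriveB.
have [|| z z_xy E] := @MVT R (fun w => G w - F w) (fun w => dG w - dF w) x y xy.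
- by move=> z; rewrite in_itv /= => /andP[z1 z2]; apply: D; rewrite !ltW.
- apply: continuous_in_subspaceT => z; rewrite inE /= in_itv /= => z_xy.
  exact: is_derive_continuous (D z z_xy).
have /Hle : x < z < y by move: z_xy; rewrite in_itv.
move: E => /= E z_le.
have : 0 <= (dG z - dF z) * (y - x) by apply: mulr_ge0; lra.
lra.
Qed.

Lemma increment_lt (R : realType) (F dF : R -> R) (x y : R) : x < y ->
  (forall z, x <= z <= y -> is_derive z 1 F (dF z)) ->
  (forall z, x < z < y -> 0 < dF z) -> F x < F y.
Proof.
move=> xy HF Hgt.
have [|| z z_xy E] := @MVT R F dF x y xy.
- by move=> z; rewrite in_itv /= => /andP[z1 z2]; apply: HF; rewrite !ltW.
- apply: continuous_in_subspaceT => z; rewrite inE /= in_itv /= => z_xy.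
  exact: is_derive_continuous (HF z z_xy).
have /Hgt : x < z < y by move: z_xy; rewrite in_itv.
move=> z_gt; have : 0 < dF z * (y - x) by apply: mulr_gt0; lra.
lra.
Qed.

(** The fundamental theorem of calculus gives an antiderivative on each interval
    ]- N, N[; normalised to vanish at 0, these agree on their common domains,
    hence glue to one on the whole line. *)
Lemma continuous_antiderivative (R : realType) (k : R -> R) : continuous k ->
  exists2 F : R -> R, F 0 = 0 & forall x : R, is_derive x 1 F (k x).
Proof.
move=> ck.
pose F_ N x : R := \int[@lebesgue_measure R]_(t in `[- N, x]) k t.
have dF_ (N x : R) : `|x| < N -> is_derive x 1 (F_ N) (k x).
  move=> /ltr_normlP[Nx xN].
  have [||||] := @continuous_FTC1_closed R k (- N) x (x + 1).
  - lra.
  - apply: continuous_compact_integrable; first exact: segment_compact.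
    exact: continuous_subspaceT.
  - lra.
  - exact: ck.
  by move=> /derivableP; rewrite -derive1E => dF <-.
have F_E (N N' x : R) : `|x| < N -> `|x| < N' -> F_ N x - F_ N 0 = F_ N' x - F_ N' 0.
  have ge N1 N2 : `|x| < N1 -> `|x| < N2 -> F_ N1 x - F_ N1 0 <= F_ N2 x - F_ N2 0.
    move=> H1 H2; case: (leP 0 x) => x0.
      rewrite ger0_norm // in H1 H2.
      apply: (@increment_le _ _ _ k k) => // z /andP[z1 z2]; apply: dF_;
        apply/ltr_normlP; split; lra.
    rewrite ltr0_norm // in H1 H2.
    rewrite -lerN2 !opprB.
    apply: (@increment_le _ _ _ k k) => // [|z /andP[z1 z2]|z /andP[z1 z2]].
    - exact: ltW.
    - by apply: dF_; apply/ltr_normlP; split; lra.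
    - by apply: dF_; apply/ltr_normlP; split; lra.
  by move=> H1 H2; apply/eqP; rewrite eq_le !ge.
exists (fun x => F_ (`|x| + 1) x - F_ (`|x| + 1) 0); first by rewrite subrr.
move=> x.
have dN : is_derive x 1 (fun y => F_ (`|x| + 2) y - F_ (`|x| + 2) 0) (k x).
  have dN := dF_ (`|x| + 2) x ltac:(lra).
  by apply: is_derive_eq; rewrite subr0.
apply: near_eq_is_derive dN.
near=> y.
apply: F_E; last by lra.
have : `|x - y| < 1 by near: y; exact: nbhsx_ballx.
have := ler_normB x (x - y); rewrite opprB addrC subrK.
lra.
Unshelve. all: by end_near. Qed.

Lemma antiderivative_primitive (R : realType) (k F : R -> R) (s : R) :
  (forall x : R, is_derive x 1 F (k x)) -> continuous k -> 0 <= s ->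
  primitive k s = F s - F 0.
Proof.
move=> dF ck; rewrite le_eqVlt => /predU1P[<-|s0].
  by rewrite subrr /primitive set_itv1 Rintegral_set1.
have cF : continuous F by move=> x; exact: is_derive_continuous (dF x).
rewrite /primitive /Rintegral (@continuous_FTC2 _ k F) //.
- exact: continuous_subspaceT.
- split.
  + by move=> x _; exact: ex_derive.
  + apply: cvg_at_right_filter; exact: cF.
  + apply: cvg_at_left_filter; exact: cF.
- by move=> x _; rewrite derive1E; exact: derive_val.
Qed.

(** * Profiles on half lines *)

(** Separation of variables: w is the inverse function of the antiderivative of
    1 / g that vanishes at p.  The bounds on g make that antiderivative a
    bijection of the line; g is replaced by g (max p s), which changes nothing
    because w stays above p for x >= 0, and makes w differentiable on both
    sides of 0. *)
Lemma autonomous_ode (R : realType) (g : R -> R) (p m M : R) :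
  continuous g -> 0 < m -> (forall s, p <= s -> m <= g s <= M) ->
  exists w : R -> R, [/\ w 0 = p, forall x : R, 0 <= x -> p + m * x <= w x
    & forall x : R, 0 <= x -> is_derive x 1 w (g (w x))].
Proof.
move=> cg m0 g_bnd.
pose G s := g (Num.max p s).
have G_bnd s : m <= G s <= M by apply: g_bnd; rewrite le_max lexx.
have G_gt0 s : 0 < G s by case/andP: (G_bnd s) => + _; exact: lt_le_trans.
have M0 : 0 < M by case/andP: (G_bnd p) => mG /(le_trans mG); exact: lt_le_trans.
have cG : continuous (fun s => (G s)^-1).
  move=> s; apply: cvgV; first by rewrite gt_eqF.
  apply: continuous_comp; last exact: cg.
  by apply: continuous_max; [exact: cvg_cst | exact: cvg_id].
have [X0 _ dX0] := @continuous_antiderivative R _ cG.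
pose X s := X0 s - X0 p.
have dX (s : R) : is_derive s 1 X (G s)^-1.
  by have := dX0 s => ?; apply: is_derive_eq; rewrite subr0.
have Xinc (s t : R) : s <= t -> (t - s) / M <= X t - X s.
  move=> st; have D (z : R) : is_derive z 1 (fun z => z / M) M^-1.
    by apply: is_derive_eq; rewrite /GRing.scale /= mulr0 add0r mulr1.
  rewrite mulrBl; apply: (@increment_le _ _ _ (fun=> M^-1) (fun z => (G z)^-1)) => // z _.
  by rewrite lef_pV2 ?posrE ?G_gt0//; case/andP: (G_bnd z).
have Xinc' (s t : R) : s <= t -> X t - X s <= (t - s) / m.
  move=> st; have D (z : R) : is_derive z 1 (fun z => z / m) m^-1.
    by apply: is_derive_eq; rewrite /GRing.scale /= mulr0 add0r mulr1.
  rewrite mulrBl; apply: (@increment_le _ _ _ (fun z => (G z)^-1) (fun=> m^-1)) => // z _.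
  by rewrite lef_pV2 ?posrE ?G_gt0//; case/andP: (G_bnd z).
have cX : continuous X by move=> s; exact: is_derive_continuous (dX s).
have Xp : X p = 0 by rewrite /X subrr.
have Xsurj x : exists s, X s = x.
  pose r := M * `|x|.
  have r0 : 0 <= r by rewrite mulr_ge0 // ltW.
  have rM : r / M = `|x| by rewrite /r mulrAC divff ?mul1r // gt_eqF.
  have [|||s _ Xs] := @IVT R X (p - r) (p + r) x.
  - lra.
  - exact: continuous_subspaceT.
  - have H1 : X (p - r) <= - `|x|.
      have := Xinc (p - r) p ltac:(lra); rewrite Xp.
      rewrite (_ : p - (p - r) = r); last by ring. rewrite rM; lra.
    have H2 : `|x| <= X (p + r).
      have := Xinc p (p + r) ltac:(lra); rewrite Xp.
      rewrite (_ : p + r - p = r); last by ring. rewrite rM; lra.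
    have := ler_norm x; have := lerNnormlW (lexx `|x|).
    rewrite ge_min le_max => ? ?; apply/andP; split; apply/orP; [left|right]; lra.
  - by exists s.
have [w Xw] := choice Xsurj.
have Xlt s t : s < t -> X s < X t.
  move=> st; have := Xinc s t (ltW st).
  have : 0 < (t - s) / M by rewrite divr_gt0 // subr_gt0.
  lra.
have wX : cancel X w.
  move=> s; apply/eqP; rewrite eq_le !leNgt.
  by apply/andP; split; apply/negP => /Xlt; rewrite Xw ltxx.
have w0 : w 0 = p by rewrite -Xp wX.
have w_ge x : 0 <= x -> p <= w x.
  by move=> x0; rewrite leNgt; apply/negP => /Xlt; rewrite Xw Xp ltNge x0.
exists w; split=> // x x0.
- have := Xinc' p (w x) (w_ge x x0).
  rewrite Xw Xp subr0 ler_pdivlMr // mulrC; lra.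
- have -> : g (w x) = (G (w x))^-1^-1.
    by rewrite invrK /G max_r // w_ge.
  have := dX (w x); have := @is_derive_inverse R X w (G (w x))^-1 (w x).
  rewrite Xw => inv dXw; apply: inv.
  + by near=> s; exact: wX.
  + by near=> s; exact: cX.
  + by rewrite invr_eq0 gt_eqF.
Unshelve. all: by end_near. Qed.

(** If w' = sqrt (2 H(w)), this says that w'' = H'(w): the energy integral of a
    second order equation turns it into a first order one. *)
Lemma is_derive_sqrt_energy (R : realType) (w H : R -> R) (x w' H' : R) :
  is_derive x 1 w w' -> is_derive (w x) 1 H H' -> 0 < H (w x) ->
  is_derive x 1 (fun y => Num.sqrt (2 * H (w y)))
    (H' * w' / Num.sqrt (2 * H (w x))).
Proof.
move=> dw dH Hgt.
have H2 : 0 < 2 * H (w x) by rewrite mulr_gt0.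
have dsq := is_derive1_sqrt H2.
have dHw : is_derive x 1 (fun y => 2 * H (w y)) (2 * (H' * w')).
  have d1 := @is_derive1_comp _ H w x H' w' dH dw.
  exact: is_derive_eq.
have := @is_derive1_comp _ Num.sqrt (fun y => 2 * H (w y)) x _ _ dsq dHw.
move=> d; apply: is_derive_eq.
have : Num.sqrt (2 * H (w x)) != 0 by rewrite gt_eqF // sqrtr_gt0.
by move=> ?; field.
Qed.

Lemma continuous_sqrt_scaled (R : realType) (H : R -> R) :
  continuous H -> continuous (fun s => Num.sqrt (2 * H s)).
Proof.
move=> cH s; apply: (@continuous_comp _ _ _ (fun s => 2 * H s) Num.sqrt).
  by apply: cvgM; [exact: cvg_cst | exact: cH].
exact: sqrt_continuous.
Qed.

(** The solution of w' = sqrt (2 (E - F(w))), hence of w'' + f(w) = 0, from p.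
    As E exceeds F on [p, 1], the slope stays away from 0 and w
    exceeds 1 in finite time.  Beyond the value 1 the potential is frozen, which keeps
    the slope bounded. *)
Lemma rising_profile (R : realType) (f F : R -> R) (E p lo hi : R) :
  (forall x : R, is_derive x 1 F (f x)) -> 0 < lo ->
  (forall s, p <= s <= 1 -> lo <= E - F s <= hi) -> p < 1 ->
  exists w wx : R -> R,
  [/\ w 0 = p /\ wx 0 = Num.sqrt (2 * (E - F p)),
      exists L, forall x, L <= x -> 1 <= w x,
      forall x : R, 0 <= x -> p <= w x /\ is_derive x 1 w (wx x)
    & forall x : R, 0 <= x -> w x < 1 -> is_derive x 1 wx (- f (w x))].
Proof.
move=> dF lo0 bnd p1.
pose H s := E - F (Num.min s 1).
have H_bnd s : p <= s -> lo <= H s <= hi.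
  by move=> ps; apply: bnd; rewrite le_min ps (ltW p1) ge_min lexx orbT.
have cH : continuous H.
  move=> s; apply: cvgB; first exact: cvg_cst.
  apply: continuous_comp; last exact: is_derive_continuous (dF _).
  by apply: continuous_min; [exact: cvg_id | exact: cvg_cst].
pose g s := Num.sqrt (2 * H s).
have cg : continuous g by exact: continuous_sqrt_scaled.
have [||w [w0 w_gt dw]] :=
  @autonomous_ode R g p (Num.sqrt (2 * lo)) (Num.sqrt (2 * hi)) cg.
- by rewrite sqrtr_gt0 mulr_gt0.
- by move=> s /H_bnd/andP[? ?]; rewrite /g !ler_wsqrtr // ler_pM2l.
have m0 : 0 < Num.sqrt (2 * lo) by rewrite sqrtr_gt0 mulr_gt0.
have w_ge x : 0 <= x -> p <= w x.
  by move=> x0; apply: le_trans (w_gt x x0); rewrite lerDl mulr_ge0 // ltW.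
exists w, (g \o w); split.
- by rewrite /= w0 /g /H min_l // ltW.
- exists (`|1 - p| / Num.sqrt (2 * lo)) => x Lx.
  have x0 : 0 <= x by apply: le_trans Lx; rewrite divr_ge0 // ltW.
  apply: le_trans (w_gt x x0); move: Lx; rewrite ler_pdivrMr // mulrC.
  have := ler_norm (1 - p); lra.
- by move=> x x0; split; [exact: w_ge | exact: dw].
move=> x x0 wx1.
have dH : is_derive (w x) 1 H (- f (w x)).
  have dF' : is_derive (w x) 1 (fun s => E - F s) (- f (w x)).
    have dFw := dF (w x).
    by have := @is_deriveB R R R (fun=> E) F (w x) 1 0 (f (w x)) _ _; rewrite sub0r; exact.
  apply: near_eq_is_derive dF'; near=> s; rewrite /H min_l // ltW //.
  by near: s; exact: lt_nbhsl.
have /andP[Hlo _] := H_bnd _ (w_ge x x0).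
have H0 : 0 < H (w x) by exact: lt_le_trans Hlo.
have := is_derive_sqrt_energy (dw x x0) dH H0.
move=> d; apply: is_derive_eq; rewrite /g mulfK // gt_eqF // sqrtr_gt0 mulr_gt0 //.
Unshelve. all: by end_near. Qed.

(** A solution of w' = - sqrt (2 H(w)), where H(eta) = 0 and H' = kap <= - f, so
    that w'' = kap(w) <= - f(w).  Taking kap = - f outright would make w reach
    eta at a finite x, with slope 0, where it would have to be glued to a
    constant.  Capping kap by a linear function vanishing at eta makes H quadratic at
    eta, and then w approaches eta exponentially without reaching it.
    The cap C is chosen so that kap = - f above q; hence the initial slope is
    at least sqrt (2 (F(q) - F(p))) in absolute value. *)
Lemma falling_profile (R : realType) (f F : R -> R) (eta q p M : R) :
  (forall x : R, is_derive x 1 F (f x)) -> continuous f ->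
  eta < q -> q <= p -> (forall s, eta <= s <= p -> - M <= f s < 0) ->
  exists w wx : R -> R,
  [/\ w 0 = p /\ wx 0 <= - Num.sqrt (2 * (F q - F p)),
      exists L, forall x, L <= x -> w x <= q,
      forall x : R, 0 <= x -> eta < w x <= p /\ is_derive x 1 w (wx x)
    & forall x : R, 0 <= x -> exists2 k, is_derive x 1 wx k & k <= - f (w x)].
Proof.
move=> dF cf eq qp f_bnd.
have ep : eta < p by exact: lt_le_trans qp.
have M0 : 0 < M by have /andP[] := f_bnd p ltac:(apply/andP; split; lra); lra.
have [m m0 mf] : exists2 m, 0 < m & forall s, eta <= s <= p -> m <= - f s.
  have [s s_in fs] := @EVT_max R f eta p (ltW ep) (continuous_subspaceT cf).
  exists (- f s); first by rewrite oppr_gt0; case/andP: (f_bnd s s_in).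
  by move=> r r_in; rewrite lerN2; exact: fs.
pose C := M / (q - eta).
have C0 : 0 < C by rewrite divr_gt0 // subr_gt0.
pose kap r := Num.min (- f r) (C * (r - eta)).
have ckap : continuous kap.
  move=> r; apply: (@continuous_min _ _ (fun r => - f r) (fun r => C * (r - eta))).
    by apply: cvgN; exact: cf.
  apply: cvgM; first exact: cvg_cst.
  by apply: cvgB; [exact: cvg_id | exact: cvg_cst].
have [K _ dK] := @continuous_antiderivative R _ ckap.
pose H r := K r - K eta.
have dH (r : R) : is_derive r 1 H (kap r).
  by have dKr := dK r; apply: is_derive_eq; rewrite subr0.
have cH : continuous H by move=> r; exact: is_derive_continuous (dH r).
have He : H eta = 0 by rewrite /H subrr.
have dsq (b r : R) : is_derive r 1 (fun r => b * (r - eta) ^+ 2 / 2) (b * (r - eta)).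
  apply: is_derive_eq; rewrite /GRing.scale /=.
  by field.
pose c0 := Num.min C (m / (p - eta)).
have c00 : 0 < c0 by rewrite lt_min C0 divr_gt0 // subr_gt0.
have H_lo r : eta <= r <= p -> c0 * (r - eta) ^+ 2 / 2 <= H r.
  move=> /andP[er rp].
  have := @increment_le _ (fun r => c0 * (r - eta) ^+ 2 / 2) H _ _ _ _ er
    (fun z _ => dsq c0 z) (fun z _ => dH z).
  rewrite He subrr expr0n /= mulr0 mul0r !subr0; apply => z /andP[ez zr].
  rewrite /kap le_min; apply/andP; split; last first.
    by rewrite ler_pM2r ?subr_gt0 // ge_min lexx.
  apply: le_trans (mf z _); last by apply/andP; split; lra.
  apply: (@le_trans _ _ (m / (p - eta) * (z - eta))).
    by rewrite ler_pM2r ?subr_gt0 // ge_min lexx orbT.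
  rewrite mulrAC ler_pdivrMr ?subr_gt0 // ler_pM2l //; lra.
have H_hi r : eta <= r -> H r <= C * (r - eta) ^+ 2 / 2.
  move=> er.
  have := @increment_le _ H (fun r => C * (r - eta) ^+ 2 / 2) _ _ _ _ er
    (fun z _ => dH z) (fun z _ => dsq C z).
  rewrite He subrr expr0n /= mulr0 mul0r !subr0; apply => z /andP[ez zr].
  by rewrite /kap ge_min lexx orbT.
have Hp : F q - F p <= H p.
  have dNF (z : R) : is_derive z 1 (fun z => - F z) (- f z).
    by have dFz := dF z; exact: is_deriveN.
  have := @increment_le _ (fun z => - F z) H _ _ _ _ qp
    (fun z _ => dNF z) (fun z _ => dH z).
  have Hq : 0 <= H q.
    apply: le_trans (H_lo q _); last by apply/andP; split; lra.
    by rewrite divr_ge0 // mulr_ge0 ?sqr_ge0 // ltW.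
  move=> inc; suff : forall z, q < z < p -> - f z <= kap z by move=> /inc; lra.
  move=> z /andP[qz zp].
  rewrite /kap le_min lexx /=.
  have /andP[Mf _] := f_bnd z ltac:(apply/andP; split; lra).
  apply: (@le_trans _ _ M); first lra.
  by rewrite /C mulrAC ler_pdivlMr ?subr_gt0 // ler_pM2l //; lra.
(* In the variable y = - ln (w - eta) the equation is y' = g(y) with g bounded
   between two positive constants. *)
pose z0 := ln (p - eta).
have ez0 : expR z0 = p - eta by rewrite lnK // posrE subr_gt0.
pose v s := eta + expR (- s).
pose g s := Num.sqrt (2 * H (v s)) / expR (- s).
have cv : continuous v.
  move=> s; apply: cvgD; first exact: cvg_cst.
  apply: (@continuous_comp _ _ _ (fun s => - s) expR).
    by apply: cvgN; exact: cvg_id.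
  exact: continuous_expR.
have cg : continuous g.
  move=> s; apply: cvgM.
    apply: (@continuous_comp _ _ _ v (fun s => Num.sqrt (2 * H s))); first exact: cv.
    exact: continuous_sqrt_scaled.
  apply: cvgV; first by rewrite gt_eqF // expR_gt0.
  apply: (@continuous_comp _ _ _ (fun s => - s) expR).
    by apply: cvgN; exact: cvg_id.
  exact: continuous_expR.
have v_gt s : eta < v s by rewrite /v ltrDl expR_gt0.
have v_le s : - z0 <= s -> v s <= p.
  by move=> zs; rewrite /v -lerBrDl -ez0 ler_expR lerNl.
have sqrt_sq b s : 0 <= b ->
    Num.sqrt (2 * (b * (v s - eta) ^+ 2 / 2)) / expR (- s) = Num.sqrt b.
  move=> b0; have -> : v s - eta = expR (- s) by rewrite /v addrC addKr.
  rewrite (_ : 2 * _ = b * expR (- s) ^+ 2); last by field.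
  rewrite sqrtrM // sqrtr_sqr.
  by rewrite gtr0_norm ?expR_gt0 // mulfK // gt_eqF // expR_gt0.
have [||y [y0 y_gt dy]] := @autonomous_ode R g (- z0) (Num.sqrt c0) (Num.sqrt C) cg.
- by rewrite sqrtr_gt0.
- move=> s sz.
  have [v1 v2] := (ltW (v_gt s), v_le s sz).
  rewrite -(sqrt_sq c0 s (ltW c00)) -(sqrt_sq C s (ltW C0)) /g.
  rewrite !ler_pM2r ?invr_gt0 ?expR_gt0 //.
  by rewrite !ler_wsqrtr // ler_pM2l // ?H_hi ?H_lo // v1.
have y_ge x : 0 <= x -> - z0 <= y x.
  by move=> x0; apply: le_trans (y_gt x x0); rewrite lerDl mulr_ge0 // sqrtr_ge0.
pose w x := v (y x).
pose wx x := - Num.sqrt (2 * H (w x)).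
have dw (x : R) : 0 <= x -> is_derive x 1 w (wx x).
  move=> x0; have dyx := dy x x0.
  have dNy : is_derive x 1 (fun x => - y x) (- g (y x)) by exact: is_deriveN.
  have dE := @is_derive1_comp _ expR (fun x => - y x) x _ _ (is_derive_expR _) dNy.
  apply: is_derive_eq; rewrite add0r /wx /g /w.
  have : expR (- y x) != 0 by rewrite gt_eqF // expR_gt0.
  by move=> ?; field.
have w0 : w 0 = p by rewrite /w y0 /v opprK ez0 addrC subrK.
exists w, wx; split.
- split=> //; rewrite /wx w0 lerN2 ler_wsqrtr // ler_pM2l //.
- pose L := (- ln (q - eta) + z0) / Num.sqrt c0.
  exists (Num.max 0 L) => x; rewrite ge_max => /andP[x0 Lx].
  rewrite /w /v -lerBrDl -[q - eta]lnK ?posrE ?subr_gt0 // ler_expR.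
  move: Lx; rewrite /L ler_pdivrMr ?sqrtr_gt0 // mulrC => Lx.
  have := y_gt x x0; lra.
- by move=> x x0; split; [rewrite v_gt v_le ?y_ge | exact: dw].
move=> x x0; exists (kap (w x)); last by rewrite /kap ge_min lexx.
have H0 : 0 < H (w x).
  apply: lt_le_trans (H_lo _ _); last by rewrite /w (ltW (v_gt _)) v_le ?y_ge.
  rewrite divr_gt0 // mulr_gt0 // exprn_even_gt0 //= subr_eq0 gt_eqF //; exact: v_gt.
have := is_derive_sqrt_energy (dw x x0) (dH (w x)) H0.
move=> d; apply: is_derive_eq; rewrite /wx mulrN mulNr opprK mulfK //.
by rewrite gt_eqF // sqrtr_gt0 mulr_gt0.
Qed.

(** * Potentials on a finite graph *)

(** A set of vertices that no edge leaves is a union of components. *)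
Lemma crossing_edge (R : realType) (D : bounded_graph R) (S : pred (vertex D)) v w :
  S v -> ~~ S w -> exists e : edge D, S (src e) != S (tgt e).
Proof.
move=> Sv Sw; apply: contrapT => noE.
have S_e (e : edge D) : S (src e) = S (tgt e).
  by apply/eqP/negPn/negP => Se; apply: noE; exists e.
have clS : fingraph.closed (Defs.adjacent (@src R D) (@tgt R D)) S.
  by move=> x y; rewrite /Defs.adjacent => /existsP[e /orP[]] /andP[/eqP<- /eqP<-]; rewrite !unfold_in S_e.
have := closed_connect clS (graph_connected v w).
by rewrite !unfold_in Sv (negbTE Sw).
Qed.

Section Potential.
Variables (R : realType) (D : bounded_graph R) (k : edge D -> R).
Hypothesis k_gt0 : forall e, 0 < k e.
Implicit Types h g : vertex D -> R.

(** The current from [src e] to [tgt e] under the potential [- h], when the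
    conductance of e is [k e]. *)
Definition edge_flux h e := k e * (h (tgt e) - h (src e)).

Definition outflow h v :=
  \sum_(e | src e == v) edge_flux h e - \sum_(e | tgt e == v) edge_flux h e.

(** Green's formula.  It is used with g = h, where the right-hand side is minus
    the energy of h, and with g the indicator function of a superlevel set of
    h, where it is minus the flux through the boundary of that set. *)
Lemma summation_by_parts g h :
  \sum_v g v * outflow h v = - \sum_e (g (tgt e) - g (src e)) * edge_flux h e.
Proof.
have by_end (p : edge D -> vertex D) (X : edge D -> R) :
    \sum_v g v * \sum_(e | p e == v) X e = \sum_e g (p e) * X e.
  rewrite [RHS](partition_big p xpredT) //=; apply: eq_bigr => v _.
  by rewrite big_distrr /=; apply: eq_bigr => e /eqP ->.
under eq_bigr do rewrite mulrBr.
rewrite sumrB !by_end -sumrB -sumrN; apply: eq_bigr => e _.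
by ring.
Qed.

(** A harmonic function has energy 0, so it takes equal values at the ends of each
    edge. *)
Lemma outflow0_const h : (forall v, outflow h v = 0) -> forall v w, h v = h w.
Proof.
move=> h0 v w.
have : \sum_e (h (tgt e) - h (src e)) * edge_flux h e = 0.
  apply: oppr_inj; rewrite -summation_by_parts oppr0 big1 // => x _.
  by rewrite h0 mulr0.
move/eqP; rewrite psumr_eq0 => [/allP E0|e _]; last first.
  by rewrite /edge_flux mulrCA -expr2 mulr_ge0 ?sqr_ge0 // ltW.
apply/eqP/negPn/negP => hvw.
have [|e] := @crossing_edge R D [pred x | h x == h v] v w (eqxx _).
  by rewrite /= eq_sym.
have := E0 e (mem_index_enum e).
rewrite /edge_flux mulrCA mulf_eq0 gt_eqF //= -expr2 sqrf_eq0 subr_eq0.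
by move=> /eqP ->; rewrite eqxx.
Qed.

(** The Laplacian kills the constants, and its image is the space of functions of
    sum zero.  Subtracting the sum of h makes it bijective, without changing
    it on functions of sum zero. *)
Definition grounded_laplacian (h : {ffun vertex D -> R^o}) : {ffun vertex D -> R^o} :=
  [ffun v => outflow h v - \sum_w h w].

Lemma grounded_laplacian_linear : linear grounded_laplacian.
Proof.
move=> a h g; apply/ffunP => v; rewrite !ffunE /outflow /edge_flux.
rewrite /GRing.scale /=.
have E (p : pred (edge D)) :
    \sum_(e | p e) k e * ((a *: h + g) (tgt e) - (a *: h + g) (src e)) =
    a * (\sum_(e | p e) k e * (h (tgt e) - h (src e))) +
    \sum_(e | p e) k e * (g (tgt e) - g (src e)).
  rewrite big_distrr -big_split /=; apply: eq_bigr => e _; rewrite !ffunE /GRing.scale /=; ring.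
have E' : \sum_w (a *: h + g) w = a * (\sum_w h w) + \sum_w g w.
  by rewrite big_distrr -big_split /=; apply: eq_bigr => w _; rewrite !ffunE.
rewrite !E E'; ring.
Qed.

HB.instance Definition _ := GRing.isLinear.Build R {ffun vertex D -> R^o}
  {ffun vertex D -> R^o} *:%R grounded_laplacian grounded_laplacian_linear.

Lemma sum_outflow h : \sum_v outflow h v = 0.
Proof.
have := summation_by_parts (fun=> 1) h.
under eq_bigr do rewrite mul1r.
by move=> ->; rewrite big1 ?oppr0 // => e _; rewrite subrr mul0r.
Qed.

Lemma poisson_solvable (s : vertex D -> R) : \sum_v s v = 0 ->
  exists h, forall v, outflow h v = s v.
Proof.
move=> s0.
have sum_gl (h : {ffun vertex D -> R^o}) :
    \sum_v grounded_laplacian h v = - (#|vertex D|%:R * \sum_w h w).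
  under eq_bigr do rewrite ffunE.
  by rewrite sumrB sum_outflow sub0r sumr_const cardE -cardT mulr_natl.
have sum0 (h : {ffun vertex D -> R^o}) :
    \sum_v grounded_laplacian h v = 0 -> \sum_w h w = 0.
  rewrite sum_gl => /eqP; rewrite oppr_eq0 mulf_eq0 => /orP[|/eqP //].
  rewrite pnatr_eq0 => /eqP card0; rewrite big1 // => w _.
  by have := fintype0 w card0.
pose L : 'End({ffun vertex D -> R^o}) := linfun grounded_laplacian.
have L_inj : (lker L == 0)%VS.
  apply/lker0P => h g; rewrite !lfunE /= => hg.
  have : grounded_laplacian (h - g) = 0 by rewrite linearB /= hg subrr.
  move=> d0; have hg0 : \sum_w (h - g) w = 0.
    by apply: sum0; rewrite d0 big1 // => v _; rewrite ffunE.
  have out0 v : outflow (h - g) v = 0.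
    by have := congr1 (fun u : {ffun vertex D -> R^o} => u v) d0; rewrite !ffunE hg0 subr0.
  apply/eqP; rewrite -subr_eq0; apply/eqP/ffunP => v; rewrite [RHS]ffunE.
  have := hg0; rewrite (eq_bigr (fun=> (h - g) v)) => [|w _]; last exact: outflow0_const.
  rewrite sumr_const => /eqP; rewrite mulrn_eq0 => /orP[/eqP card0|/eqP //].
  by have := fintype0 v card0.
have [h hs] : exists h : {ffun vertex D -> R^o}, grounded_laplacian h = [ffun v => s v].
  have : [ffun v => (s v : R^o)] \in limg L by rewrite lker0_limgf // memvf.
  by move=> /memv_imgP[h _ ->]; exists h; rewrite lfunE.
exists h => v; have := congr1 (fun u : {ffun vertex D -> R^o} => u v) hs.
rewrite !ffunE sum0 ?subr0 // hs -[RHS]s0.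
by apply: eq_bigr => w _; rewrite ffunE.
Qed.

(** Let t be the larger value of h at the ends of e.  Through the boundary of the
    set where h >= t all the fluxes have the same direction, so the flux
    through e is at most their sum, which is the sum of the sources inside. *)
Lemma flux_le_sources h e : `|edge_flux h e| <= \sum_v `|outflow h v|.
Proof.
pose t := Num.max (h (src e)) (h (tgt e)).
pose g (v : vertex D) : R := (t <= h v)%R%:R.
have term_ge0 e' : 0 <= (g (tgt e') - g (src e')) * edge_flux h e'.
  rewrite /g /edge_flux mulrCA; apply: mulr_ge0; first exact: ltW.
  by case: (leP t (h (tgt e'))); case: (leP t (h (src e'))) => /= *;
    rewrite ?subrr ?mul0r ?subr0 ?sub0r ?mul1r ?mulN1r //; lra.
have term_e : `|edge_flux h e| <= (g (tgt e) - g (src e)) * edge_flux h e.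
  rewrite /g /edge_flux /t normrM gtr0_norm // mulrCA ler_pM2l //.
  case: (ltgtP (h (src e)) (h (tgt e))) => [lt|gt|->].
  - rewrite lexx (lt_geF lt) /= subr0 mul1r gtr0_norm // subr_gt0 //.
  - rewrite lexx (lt_geF gt) /= sub0r mulN1r ltr0_norm // subr_lt0 //.
  - by rewrite subrr normr0 mulr0.
apply: (le_trans term_e); apply: (@le_trans _ _ (- \sum_v g v * outflow h v)).
  rewrite summation_by_parts opprK (bigD1 e) //= lerDl.
  exact: sumr_ge0.
rewrite -sumrN; apply: ler_sum => v _.
rewrite -mulNr; apply: le_trans (ler_norm _) _; rewrite normrM normrN.
by rewrite ler_piMl // /g normr_nat lern1 leq_b1.
Qed.

End Potential.

(** Induction on the number of vertices with a smaller value than h x.  Some edge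
    leads from {h < h x} to its complement; its lower end y satisfies the
    induction hypothesis, and this edge accounts for the difference h x - h y.
    The truncated variation T counts on each edge only the part of the variation
    of h below the level t, so that the contributions of the successive
    crossing edges do not overlap. *)
Lemma oscillation_le_variation (R : realType) (D : bounded_graph R)
    (h : vertex D -> R) v w :
  h v - h w <= \sum_e `|h (tgt e) - h (src e)|.
Proof.
pose T t := \sum_e `|Num.min t (h (tgt e)) - Num.min t (h (src e))|.
have minB (t x y : R) : `|Num.min t x - Num.min t y| <= `|x - y|.
  by case: (leP t x); case: (leP t y) => /= *;
     apply/ler_normlP; split; have := ler_norm (x - y); have := lerNnormlW (lexx `|x - y|); lra.
suff osc (n : nat) (x : vertex D) : 
    (#|[pred z | (h z < h x)%R]| <= n)%N -> h x - h w <= T (h x).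
  apply: le_trans (osc _ _ (leqnn _)) _.
  by apply: ler_sum => e _; exact: minB.
elim: n x => [|n IH] x.
  rewrite leqn0 => /eqP/card0_eq/(_ w); rewrite !inE => /negbT; rewrite -leNgt => xw.
  by apply: (@le_trans _ _ 0); [lra | exact: sumr_ge0].
move=> card_x; have [wx|xw] := ltP (h w) (h x); last first.
  by apply: (@le_trans _ _ 0); [lra | exact: sumr_ge0].
have [|e e_cross] := @crossing_edge R D [pred z | h z < h x] w x wx.
  by rewrite /= ltxx.
have [y [yx yE]] : exists y, h y < h x /\
    h x - h y <= `|Num.min (h x) (h (tgt e)) - Num.min (h x) (h (src e))|
    - `|Num.min (h y) (h (tgt e)) - Num.min (h y) (h (src e))|.
  move: e_cross => /=.
  case: (ltP (h (src e)) (h x)); case: (ltP (h (tgt e)) (h x)) => //= H1 H2 _.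
  - exists (src e); split=> //.
    by rewrite minxx !min_l ?subrr ?normr0 ?subr0 ?ler_norm //; lra.
  - exists (tgt e); split=> //.
    by rewrite minxx !min_l ?subrr ?normr0 ?subr0 //; [rewrite distrC ler_norm | lra].
have : h y - h w <= T (h y).
  apply: IH; rewrite -ltnS; apply: leq_trans card_x; apply: proper_card.
  apply/properP; split; first by apply/fintype.subsetP => z; rewrite !inE => /lt_trans; exact.
  by exists y; rewrite !inE ?ltxx.
suff : h x - h y <= T (h x) - T (h y) by lra.
rewrite /T -sumrB (bigD1 e) //=; apply: le_trans yE _; rewrite lerDl.
apply: sumr_ge0 => e' _; rewrite subr_ge0.
have := minB (h y) (Num.min (h x) (h (tgt e'))) (Num.min (h x) (h (src e'))).
by rewrite !minA !(min_l (ltW yx)).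
Qed.

(** The potential whose source at v is minus the sum of the fluxes X of the half lines
    based at v, plus the mean over the vertices of the sum of all the X.
    These sources have sum zero, so the potential exists; adding X leaves at
    each vertex the mean, which is negative.  The factor 2 is the cost of the
    mean in the norm of the sources. *)
Lemma small_core_potential (R : realType) (G : metric_graph R) (X : ray G -> R)
    (rmin p : R) (v0 : vertex (core G)) :
  0 < rmin -> (forall e : edge (core G), rmin <= ethick e) -> \sum_r X r < 0 ->
  exists h : vertex (core G) -> R,
  [/\ h v0 = p,
      forall v, rmin * `|h v - p| <= 2 * (\sum_r `|X r|) * total_length (core G)
    & forall v, outflow (fun e => ethick e / elen e) h v
                + \sum_(r | base r == v) X r < 0].
Proof.
move=> rmin0 thick_ge; set sX := \sum_r X r => sX0.
pose k (e : edge (core G)) := ethick e / elen e.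
have k_gt0 e : 0 < k e by rewrite divr_gt0 ?ethick_gt0 ?elen_gt0.
pose n : R := #|vertex (core G)|%:R.
have n0 : 0 < n by rewrite ltr0n; apply/card_gt0P; exists v0.
pose s v := sX / n - \sum_(r | base r == v) X r.
have sum_n (y : R) : \sum_(v : vertex (core G)) y / n = y.
  by rewrite sumr_const -mulr_natr mulfVK // gt_eqF.
have by_base (Y : ray G -> R) :
    \sum_v \sum_(r | base r == v) Y r = \sum_r Y r.
  by rewrite [RHS](partition_big (@base R G) xpredT).
have [h0 h0s] : exists h0, forall v, outflow k h0 v = s v.
  by apply: poisson_solvable => //; rewrite sumrB sum_n by_base subrr.
have s_le : \sum_v `|s v| <= 2 * \sum_r `|X r|.
  have sX_le : `|sX| <= \sum_r `|X r| by exact: ler_norm_sum.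
  apply: (@le_trans _ _ (\sum_v (`|sX| / n + \sum_(r | base r == v) `|X r|))).
    apply: ler_sum => v _; apply: (le_trans (ler_normB _ _)).
    by rewrite normrM normfV (gtr0_norm n0) lerD2l ler_norm_sum.
  by rewrite big_split /= sum_n by_base; lra.
set C := 2 * \sum_r `|X r| in s_le *.
pose V := \sum_e `|h0 (tgt e) - h0 (src e)|.
have V_le : rmin * V <= C * total_length (core G).
  rewrite /V /total_length !big_distrr /=; apply: ler_sum => e _.
  have := flux_le_sources k_gt0 h0 e.
  rewrite (eq_bigr (fun v => `|s v|)) => [fl|v _]; last by rewrite h0s.
  apply: (@le_trans _ _ (ethick e * `|h0 (tgt e) - h0 (src e)|)).
    by rewrite ler_wpM2r.
  have -> : ethick e * `|h0 (tgt e) - h0 (src e)| = `|edge_flux k h0 e| * elen e.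
    rewrite /edge_flux normrM (gtr0_norm (k_gt0 e)) /k mulrAC mulfVK //.
    by rewrite gt_eqF // elen_gt0.
  rewrite ler_pM2r ?elen_gt0 //; exact: le_trans fl s_le.
exists (fun v => h0 v - h0 v0 + p); split.
- by rewrite subrr add0r.
- move=> v; rewrite addrK; apply: le_trans V_le; rewrite ler_pM2l //.
  by apply/ler_normlP; split; [rewrite opprB|]; exact: oscillation_le_variation.
move=> v.
have -> : outflow k (fun v => h0 v - h0 v0 + p) v = outflow k h0 v.
  by congr (_ - _); apply: eq_bigr => e _; rewrite /edge_flux; congr (_ * _); ring.
by rewrite h0s /s subrK pmulr_llt0 // invr_gt0.
Qed.

(** * One-sided derivatives and maxima *)

(** The derivatives of solutions on the graph are limits of difference quotients in
    y; Caratheodory's criterion relates them to the limit in h = y - x. *)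
Lemma is_derive_quotientP (R : realType) (g : R -> R) (x d : R) :
  is_derive x 1 g d <-> (g y - g x) / (y - x) @[y --> x^'] --> d.
Proof.
split.
  move=> /is_derive1_caratheodory[q [gq cq <-]].
  move/continuous_withinNx : cq; apply: cvg_trans; apply: near_eq_cvg.
  near=> y; have yx : y - x != 0.
    by rewrite subr_eq0; near: y; exact: nbhs_dnbhs_neq.
  by rewrite gq mulfK.
move=> lim_q; apply/is_derive1_caratheodory.
exists (fun y => if y == x then d else (g y - g x) / (y - x)); split.
- move=> y; case: eqVneq => [->|yx]; first by rewrite !subrr mulr0.
  by rewrite mulfVK // subr_eq0.
- apply/continuous_withinNx; rewrite eqxx.
  move: lim_q; apply: cvg_trans; apply: near_eq_cvg; near=> y.
  have yx : y != x by near: y; exact: nbhs_dnbhs_neq.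
  by rewrite (negbTE yx).
- by rewrite eqxx.
Unshelve. all: by end_near. Qed.

Lemma within_cvg_at_right (R : realType) (D : set R) (q : R -> R) (x r l : R) :
  0 < r -> (forall y, x < y < x + r -> D y) ->
  q y @[y --> within D x^'] --> l -> q y @[y --> x^'+] --> l.
Proof.
move=> r0 Dr; apply: cvg_trans; apply: cvg_app => A /= DA.
have near_x : \forall y \near x, y < x + r by apply: lt_nbhsl; rewrite ltrDl.
apply: filterS2 near_x (DA : \forall y \near x, y != x -> D y -> A y).
by move=> y yr Ay xy; apply: Ay; [rewrite gt_eqF | apply: Dr; rewrite xy].
Qed.

Lemma within_cvg_at_left (R : realType) (D : set R) (q : R -> R) (x r l : R) :
  0 < r -> (forall y, x - r < y < x -> D y) ->
  q y @[y --> within D x^'] --> l -> q y @[y --> x^'-] --> l.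
Proof.
move=> r0 Dr; apply: cvg_trans; apply: cvg_app => A /= DA.
have near_x : \forall y \near x, x - r < y by apply: lt_nbhsr; rewrite ltrBlDr ltrDl.
apply: filterS2 near_x (DA : \forall y \near x, y != x -> D y -> A y).
by move=> y yr Ay xy; apply: Ay; [rewrite lt_eqF | apply: Dr; rewrite xy yr].
Qed.

Lemma quotient_cvg_at_right_le0 (R : realType) (g : R -> R) (x r l : R) :
  0 < r -> (forall y, x < y < x + r -> g y <= g x) ->
  (g y - g x) / (y - x) @[y --> x^'+] --> l -> l <= 0.
Proof.
move=> r0 g_le /cvgr_to_le; apply; near=> y.
have xy : x < y by near: y; exact: nbhs_right_gt.
rewrite pmulr_lle0 ?invr_gt0 ?subr_gt0 // subr_le0; apply: g_le; rewrite xy /=.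
by near: y; apply: nbhs_right_lt; rewrite ltrDl.
Unshelve. all: by end_near. Qed.

Lemma quotient_cvg_at_left_ge0 (R : realType) (g : R -> R) (x r l : R) :
  0 < r -> (forall y, x - r < y < x -> g y <= g x) ->
  (g y - g x) / (y - x) @[y --> x^'-] --> l -> 0 <= l.
Proof.
move=> r0 g_le /cvgr_to_ge; apply; near=> y.
have xy : y < x by near: y; exact: nbhs_left_lt.
rewrite nmulr_lge0 ?invr_lt0 ?subr_lt0 // subr_le0; apply: g_le; rewrite xy andbT.
by near: y; apply: nbhs_left_gt; rewrite ltrBlDr ltrDl.
Unshelve. all: by end_near. Qed.

Lemma is_derive_at_right (R : realType) (g : R -> R) (x d : R) :
  is_derive x 1 g d -> (g y - g x) / (y - x) @[y --> x^'+] --> d.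
Proof.
move=> /is_derive_quotientP lim_q.
apply: (@within_cvg_at_right _ setT _ _ 1) => //.
by apply: cvg_trans lim_q; apply: cvg_app; exact: cvg_within.
Qed.

Lemma is_derive_at_left (R : realType) (g : R -> R) (x d : R) :
  is_derive x 1 g d -> (g y - g x) / (y - x) @[y --> x^'-] --> d.
Proof.
move=> /is_derive_quotientP lim_q.
apply: (@within_cvg_at_left _ setT _ _ 1) => //.
by apply: cvg_trans lim_q; apply: cvg_app; exact: cvg_within.
Qed.

(** At a maximum dz x = 0; if k were positive, dz would be positive just to the
    right of x and z would exceed z x there. *)
Lemma second_derivative_max (R : realType) (z dz : R -> R) (x r k : R) :
  0 < r -> (forall y, x - r < y < x + r -> is_derive y 1 z (dz y) /\ z y <= z x) ->
  is_derive x 1 dz k -> k <= 0.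
Proof.
move=> r0 z_max dzk; rewrite leNgt; apply/negP => k0.
have [dzx _] := z_max x ltac:(apply/andP; split; lra).
have dz0 : dz x = 0.
  apply/eqP; rewrite eq_le; apply/andP; split.
    apply: (@quotient_cvg_at_right_le0 _ z x r) => //; last exact: is_derive_at_right.
    by move=> y /andP[y1 y2]; apply: (z_max y _).2; apply/andP; split; lra.
  apply: (@quotient_cvg_at_left_ge0 _ z x r) => //; last exact: is_derive_at_left.
  by move=> y /andP[y1 y2]; apply: (z_max y _).2; apply/andP; split; lra.
have : \forall y \near x^'+, 0 < (dz y - dz x) / (y - x).
  exact: cvgr_gt (is_derive_at_right dzk) _ k0.
rewrite near_withinE => /nbhs_ballP[e /= e0 e_pos].
pose r' := Num.min r e / 2.
have [r'0 r're] : 0 < r' /\ r' < Num.min r e.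
  have : 0 < Num.min r e by rewrite lt_min r0.
  by rewrite /r' => ?; split; lra.
move: r're; rewrite lt_min => /andP[r'r r'e].
have := @increment_lt _ z dz x (x + r') ltac:(lra).
have [_ z_le] := z_max (x + r') ltac:(apply/andP; split; lra).
rewrite ltNge z_le => lt_false; suff: false by [].
apply: lt_false => y /andP[y1 y2].
  by apply: (z_max y _).1; apply/andP; split; lra.
have := e_pos y; rewrite /ball /= ltr0_norm ?dz0 ?subr0; last lra.
move=> /(_ ltac:(lra)) /(_ y1).
by rewrite pmulr_lgt0 // invr_gt0 subr_gt0.
Qed.

(** * Comparison principle on a metric graph *)

Section Comparison.
Variables (R : realType) (G : metric_graph R) (f : R -> R).
Implicit Types (b : branch G) (w wx : branch G -> R -> R).

(** The left-hand side of the Kirchhoff condition. *)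
Definition outgoing_flux wx (v : vertex (core G)) : R :=
  \sum_(e | src e == v) ethick e * wx (inl e) 0
  - \sum_(e | tgt e == v) ethick e * wx (inl e) (elen e)
  + \sum_(r | base r == v) rthick r * wx (inr r) 0.

(** The differential inequality is asked only where w < 1, since a solution with
    values below 1 can touch w only there.  Strictness at the vertices, together
    with the growing perturbation below, makes a first contact impossible at once. *)
Definition strict_supersolution w wx :=
  [/\ agree_at_vertices w,
      forall b (x : R), dom b x -> 0 <= w b x /\ is_derive x 1 (w b) (wx b x),
      forall b (x : R), interior_dom b x -> w b x < 1 ->
        exists2 k, is_derive x 1 (wx b) k & k + f (w b x) <= 0
    & forall v, outgoing_flux wx v < 0].

(** The perturbation of the supersolution is proportional to this function.  On
    half lines it tends to infinity, which confines contacts to a bounded region; its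
    derivative vanishes at the vertices, so that the Kirchhoff sums do not
    change. *)
Definition growth b (x : R) : R :=
  match b with inl _ => 1 | inr _ => 1 + x ^+ 2 end.

Definition growth' b (x : R) : R :=
  match b with inl _ => 0 | inr _ => 2 * x end.

Definition growth'' b : R := match b with inl _ => 0 | inr _ => 2 end.

Lemma growth_ge1 b x : 1 <= growth b x.
Proof. by case: b => [e|r] //=; rewrite lerDl sqr_ge0. Qed.

Lemma is_derive_growth b (x : R) : is_derive x 1 (growth b) (growth' b x).
Proof.
case: b => [e|r] /=; first exact: is_derive_cst.
by apply: is_derive_eq; rewrite /GRing.scale /=; ring.
Qed.

Lemma is_derive_growth' b (x : R) : is_derive x 1 (growth' b) (growth'' b).
Proof.
case: b => [e|r] /=; first exact: is_derive_cst.
by apply: is_derive_eq; rewrite /GRing.scale /=; ring.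
Qed.

Lemma interior_dom_ball b x : interior_dom b x ->
  exists2 r, 0 < r & forall y, x - r < y < x + r -> interior_dom b y.
Proof.
case: b => [e|r] /= => [/andP[x0 xe]|x0].
  have : 0 < Num.min x (elen e - x) by rewrite lt_min x0 subr_gt0.
  exists (Num.min x (elen e - x)) => // y.
  by case: (leP x (elen e - x)) => ? /andP[? ?]; apply/andP; split; lra.
by exists x => // y /andP[? ?]; lra.
Qed.

Lemma interior_sub_dom b x : interior_dom b x -> dom b x.
Proof. by case: b => [e|r] /=; [case/andP => *; rewrite !ltW | exact: ltW]. Qed.

Lemma dom0 b : dom b 0.
Proof. by case: b => [e|r] /=; rewrite lexx //= ltW // elen_gt0. Qed.

Lemma dom_elen e : dom (inl e : branch G) (elen e).
Proof. by rewrite /= lexx andbT ltW // elen_gt0. Qed.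

Lemma within_is_derive b (g dg : R -> R) x :
  is_derive_within (dom b) g dg -> interior_dom b x -> is_derive x 1 g (dg x).
Proof.
move=> dg_w x_in; apply/is_derive_quotientP.
have := dg_w x (interior_sub_dom x_in).
apply: cvg_trans; apply: cvg_app => A /= DA.
have [r r0 Dr] := interior_dom_ball x_in.
have near_x : \forall y \near x, x - r < y < x + r.
  near=> y; apply/andP; split; near: y.
    by apply: lt_nbhsr; rewrite ltrBlDr ltrDl.
  by apply: lt_nbhsl; rewrite ltrDl.
apply: filterS2 near_x (DA : \forall y \near x, y != x -> dom b y -> A y).
by move=> y /Dr/interior_sub_dom y_in Ay yx; exact: Ay.
Unshelve. all: by end_near. Qed.

Lemma is_derive_withinB (D : set R) (g h dg dh : R -> R) :
  is_derive_within D g dg -> (forall x : R, D x -> is_derive x 1 h (dh x)) ->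
  is_derive_within D (fun x => g x - h x) (fun x => dg x - dh x).
Proof.
move=> g_w dh_ x Dx.
have /is_derive_quotientP h_q := dh_ x Dx.
have h_w : (h y - h x) / (y - x) @[y --> within D x^'] --> dh x.
  by apply: cvg_trans h_q; apply: cvg_app; exact: cvg_within.
have E : (fun y => (g y - h y - (g x - h x)) / (y - x)) =
    (fun y => (g y - g x) / (y - x)) \- (fun y => (h y - h x) / (y - x)).
  by apply/funext => y; rewrite /= -mulrBl; congr (_ / _); ring.
by rewrite E; exact: cvgB (g_w x Dx) h_w.
Qed.

Lemma within_continuous_comp (S T U : topologicalType) (A : set T)
    (g : T -> U) (h : S -> T) :
  {within A, continuous g} -> continuous h -> (forall s, A (h s)) ->
  continuous (g \o h).
Proof.
move=> cg ch Ah s.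
have cgh : g y @[y --> within A (nbhs (h s))] --> g (h s).
  by have := cg (h s); rewrite /continuous_at /nbhs /= -nbhs_subspace_in.
move=> B /cgh /= AB.
have hs : \forall t \near s, A (h t) -> B (g (h t)).
  exact: ch s _ (AB : \forall y \near h s, A y -> B (g y)).
suff : \forall t \near s, B (g (h t)) by [].
by near=> t; apply: (near hs t).
Unshelve. all: by end_near. Qed.

(** Otherwise u meets the perturbed supersolution W at a first time t0 > T, at some
    point x0.  If x0 is interior to a branch, then there u_t >= W_t and
    u_xx <= W_xx, so that W_t <= W_xx + f(W); the rate K + 3 of the exponential
    excludes this, because f(W) - f(w) <= K (W - w) and growth'' <= 2 growth.
    If x0 is a vertex, then along every branch the outward derivative of u is at
    most that of W; the Kirchhoff sum is 0 for u and negative for W. *)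
Lemma perturbed_comparison (K d T : R) u w wx :
  0 < K -> (forall s t, 0 <= s -> s <= t -> t <= 1 -> f t - f s <= K * (t - s)) ->
  entire_solution f u -> (forall t b x, dom b x -> 0 < u t b x < 1) ->
  strict_supersolution w wx -> (forall b x, dom b x -> u T b x <= w b x) ->
  0 < d -> forall t b x, T <= t -> dom b x ->
  u t b x < w b x + d * expR ((K + 3) * (t - T)) * growth b x.
Proof.
move=> K0 fK [ux [cu u_agree u_x u_eq u_kirch]] u01 [w_agree w_x w_eq w_flux] uT d0.
pose A t := d * expR ((K + 3) * (t - T)).
have A_gt0 t : 0 < A t by rewrite mulr_gt0 ?expR_gt0.
have A_ge t : T <= t -> d <= A t.
  move=> Tt; rewrite ler_peMr ?(ltW d0) //; apply: le_trans (expR_ge1Dx _).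
  rewrite lerDl mulr_ge0; lra.
have dA (t : R) : is_derive t 1 A ((K + 3) * A t).
  have dl : is_derive t 1 (fun t => (K + 3) * (t - T)) (K + 3).
    by apply: is_derive_eq; rewrite /GRing.scale /=; ring.
  have dE := @is_derive1_comp _ expR _ t _ _ (is_derive_expR _) dl.
  apply: is_derive_eq; rewrite /A /GRing.scale /=; ring.
pose W t b x := w b x + A t * growth b x.
move=> t1 b1 x1 Tt1 b1x1; rewrite ltNge; apply/negP => u_ge.
(* The contacts up to time t1, which lie in a compact part of each branch. *)
pose S b := [set p : R * R | T <= p.1 <= t1 /\ (dom b p.2 /\ W p.1 b p.2 <= u p.1 b p.2)].
have S_compact b : compact (S b).
  pose X := match b with inl e => elen e | inr _ => d^-1 + 1 end.
  pose Kb : set (R * R) := `[T, t1] `*` `[0, X].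
  have Kb_dom p : Kb p -> dom b p.2.
    case: p => t x [_]; rewrite /X; case: (b) => [e|r] /=; rewrite in_itv //=.
    by case/andP.
  (* On a half line, d (1 + x^2) <= W <= u < 1 bounds x by 1/d + 1. *)
  have SE : S b = Kb `&` [set p | 0 <= u p.1 b p.2 - W p.1 b p.2].
    apply/seteqP; split=> -[t x] /=.
      move=> [/andP[Tt tt1] [bx Wu]]; rewrite subr_ge0; split=> //; split.
        by rewrite /= in_itv /= Tt.
      rewrite /= in_itv /= /X.
      have /andP[_ u1] := u01 t b x bx.
      have [w0 _] := w_x b x bx.
      have Ag : d * growth b x < 1.
        apply: le_lt_trans u1; apply: le_trans Wu; rewrite /W.
        apply: (@le_trans _ _ (A t * growth b x)); last lra.
        rewrite ler_wpM2r ?A_ge //; have := growth_ge1 b x; lra.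
      case: (b) bx Ag => [e|r] //= x_ge0; rewrite x_ge0 /=.
      rewrite -ltr_pdivlMl // mulr1 => Ag.
      rewrite leNgt; apply/negP => xlt.
      have d'0 : 0 < d^-1 by rewrite invr_gt0.
      have : x * 1 <= x * x by rewrite ler_wpM2l //; lra.
      by rewrite mulr1 -expr2; lra.
    move=> [Kp]; rewrite subr_ge0 => Wu; have := Kb_dom _ Kp; move: Kp.
    by move=> [/=]; rewrite !in_itv /= => ? _ ?; split.
  have cZ : {within Kb, continuous (fun p : R * R => u p.1 b p.2 - W p.1 b p.2)}.
    have cuK : {within Kb, continuous (fun p : R * R => u p.1 b p.2)}.
      by apply: continuous_subspaceW (cu b) => p; exact: Kb_dom.
    have cWK : {within Kb, continuous (fun p : R * R => W p.1 b p.2)}.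
      apply: continuous_in_subspaceT => p /set_mem Kp.
      have [_ dw] := w_x b p.2 (Kb_dom p Kp).
      apply: cvgD.
        apply: (@continuous_comp _ _ _ snd (w b)); first exact: cvg_snd.
        exact: is_derive_continuous dw.
      apply: cvgM.
        apply: (@continuous_comp _ _ _ fst A); first exact: cvg_fst.
        exact: is_derive_continuous (dA _).
      apply: (@continuous_comp _ _ _ snd (growth b)); first exact: cvg_snd.
      exact: is_derive_continuous (is_derive_growth b _).
    by move=> p; apply: cvgB; [exact: cuK | exact: cWK].
  have : closed ([set p | 0 <= u p.1 b p.2 - W p.1 b p.2] : set (subspace Kb)).
    exact: (continuous_closedP _).1 cZ _ (@closed_ge R 0).
  move=> /closed_subspaceP[V cV VK]; rewrite SE setIC -VK setIC.
  by apply: compact_closedI cV; apply: compact_setX; exact: segment_compact.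
have S_min b : exists q, S b !=set0 -> S b q /\ forall p, S b p -> q.1 <= p.1.
  have [S0|S0] := pselect (S b !=set0); last by exists (0, 0).
  have [|q /set_mem Sq q_min] := @compact_EVT_min _ R fst (S b) S0 (S_compact b).
    by apply: continuous_subspaceT => p; exact: cvg_fst.
  by exists q => _; split=> // p Sp; apply: q_min; exact: mem_set.
have [tau tau_min] := choice S_min.
have [b0 [t0 [x0 [[/andP[Tt0' t0t1] [b0x0 W_le]] t0_min]]]] : exists b0 t0 x0, S b0 (t0, x0) /\
    forall b p, S b p -> t0 <= p.1.
  have Sb1 : S b1 !=set0 by exists (t1, x1); split=> //=; rewrite Tt1 lexx.
  have [b0 /asboolP Sb0 b0_min] :=
    @arg_minP _ R _ b1 (fun b => `[< S b !=set0 >]) (fun b => (tau b).1) (asboolT Sb1).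
  have [] := tau_min b0 Sb0; move: b0_min; case: (tau b0) => t0 x0 /= b0_min Stau _.
  exists b0, t0, x0; split=> // b p Sp.
  have Sb : S b !=set0 by exists p.
  by apply: le_trans (b0_min b (asboolT Sb)) _; apply: (tau_min b Sb).2.
rewrite /= in Tt0' t0t1 b0x0 W_le.
have before t b x : T <= t -> t < t0 -> dom b x -> u t b x < W t b x.
  move=> Tt tt0 bx; rewrite ltNge; apply/negP => Wu.
  have Sb : S b (t, x) by split; [rewrite /= Tt /=; lra | split].
  by have := t0_min _ _ Sb; rewrite /= leNgt tt0.
have Tt0 : T < t0.
  rewrite lt_neqAle Tt0' andbT; apply/eqP => TE.
  have := uT _ _ b0x0; have := A_gt0 T; have := growth_ge1 b0 x0.
  move: W_le; rewrite /W -TE /= => *.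
  have : 0 < A T * growth b0 x0 by rewrite mulr_gt0 //; lra.
  lra.
have at_t0 b x : dom b x -> u t0 b x <= W t0 b x.
  move=> bx; rewrite -subr_ge0.
  have cz : {for t0, continuous (fun t => W t b x - u t b x)}.
    apply: cvgB.
      apply: cvgD; first exact: cvg_cst.
      by apply: cvgM; [exact: is_derive_continuous (dA _) | exact: cvg_cst].
    apply: (within_continuous_comp (h := fun t => (t, x)) (cu b)) => // t.
    move=> P /= [[P1 P2] /= [P1t P2x] P12].
    have P1_near : \forall s \near t, P1 s by [].
    suff : \forall s \near t, P (s, x) by [].
    by near=> s; apply: P12; split=> /=; [near: s | exact: nbhs_singleton P2x].
  apply: (cvgr_to_ge (cvg_at_left_filter cz)); near=> t.
  rewrite subr_ge0 ltW //; apply: before => //.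
  by near: t; exact: nbhs_left_ge.
have touch : u t0 b0 x0 = W t0 b0 x0 by apply/eqP; rewrite eq_le at_t0.
pose z b x := u t0 b x - W t0 b x.
pose zx b x := ux t0 b x - (wx b x + A t0 * growth' b x).
have z_le b x y : dom b x -> dom b y -> u t0 b x = W t0 b x -> z b y <= z b x.
  by move=> bx bY E; rewrite /z E subrr subr_le0 at_t0.
have z_x b : is_derive_within (dom b) (z b) (zx b).
  apply: is_derive_withinB; first by have [] := u_x t0 b.
  move=> x bx; have [_ dw] := w_x b x bx; have dg := is_derive_growth b x.
  by apply: is_derive_eq; rewrite /GRing.scale /=; ring.
(* touching in the interior of a branch *)
have interior_false : interior_dom b0 x0 -> False.
  move=> x0_in.
  have A0 := A_gt0 t0; have g1 := growth_ge1 b0 x0.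
  have Ag : A t0 <= A t0 * growth b0 x0 by rewrite ler_peMr // ltW.
  have [w_ge0 _] := w_x _ _ b0x0.
  have /andP[_ u1] := u01 t0 _ _ b0x0.
  have uE : u t0 b0 x0 = w b0 x0 + A t0 * growth b0 x0 by [].
  have [|k dwx k_le] := w_eq _ _ x0_in; first lra.
  have [/derivableP du_t /derivableP du_xx] := u_eq t0 _ _ x0_in.
  rewrite !derive1E; set ut := 'D_1 _ t0; set uxx := 'D_1 _ x0 => eq_u.
  have uxx_le : uxx <= k + A t0 * growth'' b0.
    rewrite -subr_le0.
    have [r r0 Dr] := interior_dom_ball x0_in.
    apply: (second_derivative_max (z := z b0) (dz := zx b0) r0).
      move=> y /Dr y_in; split; first exact: within_is_derive (z_x b0) y_in.
      by apply: z_le => //; exact: interior_sub_dom.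
    have dg := is_derive_growth' b0 x0.
    have dW : is_derive x0 1 (fun y => wx b0 y + A t0 * growth' b0 y)
        (k + A t0 * growth'' b0).
      by apply: is_derive_eq; rewrite /GRing.scale /=; ring.
    exact: is_deriveB du_xx dW.
  have ut_ge : (K + 3) * A t0 * growth b0 x0 <= ut.
    rewrite -subr_ge0.
    apply: (@quotient_cvg_at_left_ge0 _ (fun t => u t b0 x0 - W t b0 x0) t0 (t0 - T)).
    - by rewrite subr_gt0.
    - move=> t; rewrite opprB addrC subrK => /andP[Tt tt0].
      by rewrite touch subrr subr_le0 ltW //; apply: before => //; exact: ltW.
    - apply: is_derive_at_left.
      have dAt := dA t0.
      have dW : is_derive t0 1 (fun t => w b0 x0 + A t * growth b0 x0)
          ((K + 3) * A t0 * growth b0 x0).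
        by apply: is_derive_eq; rewrite /GRing.scale /=; ring.
      exact: is_deriveB du_t dW.
  have f_le := fK (w b0 x0) (u t0 b0 x0) w_ge0 ltac:(lra) (ltW u1).
  have gg : A t0 * growth'' b0 <= 2 * (A t0 * growth b0 x0).
    by case: (b0) Ag => [e|r] /= Ag; lra.
  rewrite uE in f_le eq_u; lra.
have [gU [U_src U_tgt U_ray]] := u_agree t0.
have [gW [W_src W_tgt W_ray]] := w_agree.
have vertex_false v : gU v = gW v + A t0 -> False.
  move=> gv.
  have z_src e : src e = v -> ux t0 (inl e) 0 <= wx (inl e) 0.
    move=> ev; have : zx (inl e) 0 <= 0.
      apply: (@quotient_cvg_at_right_le0 _ (z (inl e)) 0 (elen e)).
      - exact: elen_gt0.
      - move=> y; rewrite add0r => /andP[y0 ye]; apply: z_le.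
        + exact: dom0.
        + by rewrite /= !ltW.
        + by rewrite U_src /W W_src ev gv mulr1.
      - apply: (within_cvg_at_right (elen_gt0 e)) (z_x _ _ (dom0 _)).
        by move=> y; rewrite add0r => /andP[y0 ye]; rewrite /= !ltW.
    by rewrite /zx /= mulr0 addr0 subr_le0.
  have z_tgt e : tgt e = v -> wx (inl e) (elen e) <= ux t0 (inl e) (elen e).
    move=> ev; have : 0 <= zx (inl e) (elen e).
      apply: (@quotient_cvg_at_left_ge0 _ (z (inl e)) (elen e) (elen e)).
      - exact: elen_gt0.
      - move=> y; rewrite subrr => /andP[y0 ye]; apply: z_le.
        + exact: dom_elen.
        + by rewrite /= !ltW.
        + by rewrite U_tgt /W W_tgt ev gv mulr1.
      - apply: (within_cvg_at_left (elen_gt0 e)) (z_x _ _ (dom_elen _)).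
        by move=> y; rewrite subrr => /andP[y0 ye]; rewrite /= !ltW.
    by rewrite /zx /= mulr0 addr0 subr_ge0.
  have z_ray r : base r = v -> ux t0 (inr r) 0 <= wx (inr r) 0.
    move=> rv; have : zx (inr r) 0 <= 0.
      apply: (@quotient_cvg_at_right_le0 _ (z (inr r)) 0 1) => //.
      - move=> y; rewrite add0r => /andP[y0 ye]; apply: z_le.
        + exact: dom0.
        + by rewrite /= ltW.
        + by rewrite U_ray /W W_ray rv gv /= expr0n addr0 mulr1.
      - apply: (within_cvg_at_right ltr01) (z_x _ _ (dom0 _)).
        by move=> y; rewrite add0r => /andP[y0 ye]; rewrite /= ltW.
    by rewrite /zx /= !mulr0 addr0 subr_le0.
  have := w_flux v; rewrite ltNge => /negP; apply.
  rewrite -(u_kirch t0 v) /outgoing_flux.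
  apply: lerD; first apply: lerB.
  - by apply: ler_sum => e /eqP/z_src; rewrite ler_pM2l // ethick_gt0.
  - by apply: ler_sum => e /eqP/z_tgt; rewrite ler_pM2l // ethick_gt0.
  - by apply: ler_sum => r /eqP/z_ray; rewrite ler_pM2l // rthick_gt0.
case: b0 b0x0 touch interior_false {t0_min W_le} => [e|r] /=.
  move=> /andP[]; rewrite le_eqVlt => /predU1P[<- _|x0_gt0].
    rewrite U_src /W W_src mulr1 => gv _; exact: vertex_false gv.
  rewrite le_eqVlt => /predU1P[->|x0_lt].
    rewrite U_tgt /W W_tgt mulr1 => gv _; exact: vertex_false gv.
  by rewrite x0_gt0 x0_lt => _; apply.
rewrite le_eqVlt => /predU1P[<-|x0_gt0].
  rewrite U_ray /W W_ray /= expr0n addr0 mulr1 => gv _; exact: vertex_false gv.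
by rewrite x0_gt0 => _; apply.
Unshelve. all: by end_near. Qed.

(** If u exceeded w at a point, the perturbation could be scaled so that the
    perturbed bound equals u there, against the previous lemma. *)
Lemma comparison (K T : R) u w wx :
  0 < K -> (forall s t, 0 <= s -> s <= t -> t <= 1 -> f t - f s <= K * (t - s)) ->
  entire_solution f u -> (forall t b x, dom b x -> 0 < u t b x < 1) ->
  strict_supersolution w wx -> (forall b x, dom b x -> u T b x <= w b x) ->
  forall t b x, T <= t -> dom b x -> u t b x <= w b x.
Proof.
move=> K0 fK u_sol u01 w_sup uT t b x Tt bx; rewrite leNgt; apply/negP => wu.
pose B := expR ((K + 3) * (t - T)) * growth b x.
have B0 : 0 < B by rewrite mulr_gt0 ?expR_gt0 //; apply: lt_le_trans (growth_ge1 b x).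
have d0 : 0 < (u t b x - w b x) / B by rewrite divr_gt0 // subr_gt0.
have := perturbed_comparison K0 fK u_sol u01 w_sup uT d0 Tt bx.
by rewrite -mulrA mulfVK ?gt_eqF // addrC subrK ltxx.
Qed.


End Comparison.

(** * Behaviour of the front-like solution at early times *)

(** At a very negative time T, u is close to phi(- x - c T) on the half line i, with an
    argument that is large when x <= L, and close to 0 elsewhere. *)
Lemma front_like_small (R : realType) (G : metric_graph R) (f phi : R -> R)
    (c : R) (i : ray G) u (L eta : R) :
  front_like_solution f phi c i u -> 0 < c -> (forall y, 0 < phi y < 1) ->
  phi y @[y --> +oo] --> (0 : R) -> 0 < eta ->
  exists T, (forall b x, b != inr i -> dom b x -> u T b x <= eta) /\
            (forall x, 0 <= x <= L -> u T (inr i) x <= eta).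
Proof.
move=> [_ u01 lim_u] c0 phi01 phi0 eta0.
have [Y [_ phi_small]] : \forall y \near +oo, phi y < eta / 2.
  by apply: (cvgr_lt _ phi0); rewrite divr_gt0.
set sup1 := fun t => sup [set `|u t (inr i) x - phi (- x - c * t)| | x in dom (inr i)].
set sup2 := fun t => sup [set z | exists b x, [/\ b != inr i, dom b x & z = `|u t b x|]].
have [T [sT TL]] : exists T, sup1 T + sup2 T < eta / 2 /\ Y < - L - c * T.
  near (-oo : set_system R) => T; exists T; split.
    by near: T; apply: (cvgr_lt _ lim_u); rewrite divr_gt0.
  suff : T < (- L - Y) / c by rewrite ltr_pdivlMr // mulrC; lra.
  by near: T; apply: nbhs_ninfty_lt; exact: num_real.
have bnd1 x : 0 <= x -> `|u T (inr i) x - phi (- x - c * T)| <= sup1 T.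
  move=> x0; apply: ub_le_sup; last by exists x.
  exists 1 => _ [y y0 <-]; have /andP[u0 u1] := u01 T (inr i) y y0.
  have /andP[p0 p1] := phi01 (- y - c * T).
  by apply/ler_normlP; split; lra.
have bnd2 b x : b != inr i -> dom b x -> `|u T b x| <= sup2 T.
  move=> bi bx; apply: ub_le_sup; last by exists b, x.
  exists 1 => _ [b' [y [_ b'y ->]]]; have /andP[u0 u1] := u01 T b' y b'y.
  by apply/ler_normlP; split; lra.
have sup1_ge0 : 0 <= sup1 T by apply: le_trans (bnd1 0 (lexx _)).
have sup2_ge0 : 0 <= sup2 T.
  rewrite /sup2; set E := [set z | _].
  have [[z Ez]|E0] := pselect (E !=set0).
    case: Ez (Ez) => b [x [bi bx ->]] _; exact: le_trans (bnd2 b x bi bx).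
  by rewrite sup_out // => -[].
exists T; split.
  move=> b x bi bx; have := bnd2 b x bi bx; have := ler_norm (u T b x); lra.
move=> x /andP[x0 xL]; have := bnd1 x x0.
have := ler_norm (u T (inr i) x - phi (- x - c * T)).
have := phi_small (- x - c * T) ltac:(lra); lra.
Unshelve. all: by end_near. Qed.

Lemma one_sided_lipschitz (R : realType) (f : R -> R) :
  (forall x, derivable f x 1) -> continuous (derive1 f) ->
  exists2 K : R, 0 < K &
    forall s t, 0 <= s -> s <= t -> t <= 1 -> f t - f s <= K * (t - s).
Proof.
move=> df cf'.
have [m _ f'_le] := EVT_max ler01 (continuous_subspaceT cf').
exists (Num.max 1 (derive1 f m)); first by rewrite lt_max ltr01.
move=> s t s0 st t1; rewrite mulrBr.
have dlin (z : R) : is_derive z 1 (fun z => Num.max 1 (derive1 f m) * z) (Num.max 1 (derive1 f m)).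
  by apply: is_derive_eq; rewrite /GRing.scale /=; ring.
apply: (@increment_le _ f _ (derive1 f) (fun=> Num.max 1 (derive1 f m))) => // z /andP[sz zt].
  by rewrite derive1E; exact/derivableP.
by rewrite le_max f'_le ?orbT // in_itv /=; apply/andP; split; lra.
Qed.

(** * The stationary barrier and blocking *)

Section BistablePotential.
Variables (R : realType) (f F : R -> R) (a : R).
Hypothesis f_bistable : bistable f a.
Hypothesis F' : forall x : R, is_derive x 1 F (f x).
Hypothesis F0 : F 0 = 0.

Lemma bistable_continuous : continuous f.
Proof.
have [[df _] _ _ _ _] := f_bistable.
by move=> x; apply: differentiable_continuous; apply/derivable1_diffP.
Qed.

Lemma potential_continuous : continuous F.
Proof. by move=> x; exact: is_derive_continuous (F' x). Qed.

Lemma potential_decreasing x y : 0 <= x -> x <= y -> y <= a -> F y <= F x.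
Proof.
have [_ _ _ [f_neg _] _] := f_bistable.
move=> x0 xy ya; have d0 (z : R) : is_derive z 1 (fun=> 0 : R) 0 by exact: is_derive_cst.
rewrite -subr_le0 -(subrr (0 : R)).
apply: (@increment_le _ F (fun=> 0) f (fun=> 0)) => // z /andP[xz zy].
by rewrite ltW // f_neg //; apply/andP; split; lra.
Qed.

Lemma potential_increasing x y : a <= x -> x <= y -> y <= 1 -> F x <= F y.
Proof.
have [_ _ _ [_ f_pos] _] := f_bistable.
move=> x0 xy ya; have d0 (z : R) : is_derive z 1 (fun=> 0 : R) 0 by exact: is_derive_cst.
rewrite -subr_ge0 -(subrr (0 : R)).
apply: (@increment_le _ (fun=> 0) F (fun=> 0) f) => // z /andP[xz zy].
by rewrite ltW // f_pos //; apply/andP; split; lra.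
Qed.

Lemma potential1_gt0 : 0 < F 1.
Proof.
have [_ _ _ _ [_ _ _]] := f_bistable.
by rewrite (antiderivative_primitive F' bistable_continuous) ?ler01 // F0 subr0.
Qed.

Lemma potential_bounds s : 0 <= s <= 1 -> F a <= F s <= F 1.
Proof.
have [_ /andP[a0 a1] _ _ _] := f_bistable.
move=> /andP[s0 s1]; have [sa|as_] := leP s a.
  rewrite potential_decreasing //=.
  have := potential_decreasing (lexx 0) s0 sa; have := potential1_gt0.
  by rewrite F0; lra.
by rewrite !potential_increasing ?lexx // ltW.
Qed.

(** At th = 0 the last inequality is the hypothesis, since F 0 = 0; each side is
    continuous in th. *)
Lemma blocking_margin (r : R) : F 1 + (r ^+ 2 - 1) * F a < 0 ->
  exists th : R, [/\ 0 < th, 10 * th < a &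
    F 1 + th - F (a - 2 * th) < r ^+ 2 * (F (2 * th) - F (a - 3 * th))].
Proof.
have [_ /andP[a0 a1] _ _ _] := f_bistable.
move=> blocking.
pose g th := F 1 + th - F (a - 2 * th) - r ^+ 2 * (F (2 * th) - F (a - 3 * th)).
have cF (l : R -> R) : {for 0, continuous l} -> {for 0, continuous (fun th => F (l th))}.
  by move=> cl; apply: (@continuous_comp _ _ _ l F) => //; exact: potential_continuous.
have cmul (e : R) : {for 0, continuous (fun th : R => e * th)}.
  by apply: cvgM; [exact: cvg_cst | exact: cvg_id].
have caff (b e : R) : {for 0, continuous (fun th : R => b - e * th)}.
  by apply: cvgB; [exact: cvg_cst | exact: cmul].
have cg : {for 0, continuous g}.
  apply: cvgB.
    by apply: cvgB; [apply: cvgD; [exact: cvg_cst | exact: cvg_id] | exact: cF].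
  by apply: cvgM; [exact: cvg_cst | apply: cvgB; exact: cF].
have g0 : g 0 < 0 by rewrite /g !mulr0 !subr0 F0 addr0; lra.
near (0 : R)^'+ => th; exists th; split.
- by near: th; exact: nbhs_right_gt.
- rewrite mulrC -ltr_pdivlMr //; near: th; apply: nbhs_right_lt; lra.
- rewrite -subr_lt0; near: th; exact: cvgr_lt (cvg_at_right_filter cg) _ g0.
Unshelve. all: by end_near. Qed.

(** The slopes at 0 of the profiles are compared with bounds that do not depend
    on eta or on the values of h, so that one potential h serves for
    all small eta.  Falling profiles start above a - 3 th and tend to eta, and F
    decreases on [0, a]; hence their slopes are at least
    sqrt (2 (F(2 th) - F(a - 3 th))) in absolute value. *)
Lemma blocking_supersolution (G : metric_graph R) (i : ray G) (h : vertex (core G) -> R)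
    (th eta : R) : 10 * th < a -> 0 < eta -> eta < th ->
  h (base i) = a - 2 * th -> (forall v, a - 3 * th < h v < a - th) ->
  (forall v, outflow (fun e => ethick e / elen e) h v
     + \sum_(r | base r == v) rthick r *
         (if r == i then Num.sqrt (2 * (F 1 + th - F (a - 2 * th)))
          else - Num.sqrt (2 * (F (2 * th) - F (a - 3 * th)))) < 0) ->
  exists w wx : branch G -> R -> R,
  [/\ strict_supersolution f w wx,
      forall b x, dom b x -> eta <= w b x,
      exists L, forall x, L <= x -> 1 <= w (inr i) x
    & forall j, j != i -> exists L, forall x, L <= x -> w (inr j) x <= 2 * eta].
Proof.
have [_ /andP[a0 a1] _ [f_neg _] _] := f_bistable.
move=> th_a eta0 eta_th hi h_bnd h_flux.
have [m _ f_m] := EVT_min ler01 (continuous_subspaceT bistable_continuous).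
pose slope e := (h (tgt e) - h (src e)) / elen e.
pose slope0 r := if r == i then Num.sqrt (2 * (F 1 + th - F (a - 2 * th)))
  else - Num.sqrt (2 * (F (2 * th) - F (a - 3 * th))).
have profile r : exists q : (R -> R) * (R -> R),
  [/\ q.1 0 = h (base r) /\ q.2 0 <= slope0 r,
      forall x : R, 0 <= x -> eta <= q.1 x /\ is_derive x 1 q.1 (q.2 x),
      forall x : R, 0 <= x -> q.1 x < 1 ->
        exists2 k, is_derive x 1 q.2 k & k + f (q.1 x) <= 0
    & exists L, forall x, L <= x ->
        if r == i then 1 <= q.1 x else q.1 x <= 2 * eta].
  rewrite /slope0; case: eqVneq => [->|ri].
    have [|s /andP[ps s1]||w [wx [[w0 wx0] wL dw dwx]]] :=
        @rising_profile _ f F (F 1 + th) (a - 2 * th) th (F 1 + th - F a) F'.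
    - lra.
    - have /andP[? ?] := potential_bounds (s := s) ltac:(apply/andP; split; lra).
      by apply/andP; split; lra.
    - lra.
    exists (w, wx); split=> //=.
    - by rewrite w0 hi wx0.
    - by move=> x /dw[w_ge dwx']; split=> //; lra.
    - by move=> x x0 wx1; exists (- f (w x)); [exact: dwx | rewrite addNr].
  have /andP[h1 h2] := h_bnd (base r).
  have [|||s /andP[s1 s2]|w [wx [[w0 wx0] wL dw dwx]]] :=
      @falling_profile _ f F eta (2 * eta) (h (base r)) (- f m) F'.
  - exact: bistable_continuous.
  - lra.
  - lra.
  - rewrite opprK f_neg ?andbT; last by apply/andP; split; lra.
    by apply: f_m; rewrite in_itv /=; apply/andP; split; lra.
  exists (w, wx); split=> //=.
  - split=> //; apply: le_trans wx0 _; rewrite lerN2 ler_wsqrtr // ler_pM2l //.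
    have := @potential_decreasing (2 * eta) (2 * th) ltac:(lra) ltac:(lra) ltac:(lra).
    have := @potential_decreasing (a - 3 * th) (h (base r)) ltac:(lra) ltac:(lra) ltac:(lra).
    lra.
  - by move=> x /dw[/andP[w_gt _] dwx']; split=> //; exact: ltW.
  - by move=> x x0 _; have [k dk k_le] := dwx x x0; exists k => //; lra.
have [q q_prop] := choice profile.
pose w (b : branch G) x := match b with
  | inl e => h (src e) + slope e * x | inr r => (q r).1 x end.
pose wx (b : branch G) x := match b with
  | inl e => slope e | inr r => (q r).2 x end.
have slope_len e : slope e * elen e = h (tgt e) - h (src e).
  by rewrite /slope mulfVK // gt_eqF // elen_gt0.
have w_edge e x : 0 <= x <= elen e -> a - 3 * th <= w (inl e) x <= a - th.
  move=> /andP[x0 xe]; rewrite /w /slope.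
  have e0 := elen_gt0 e.
  have -> : h (src e) + (h (tgt e) - h (src e)) / elen e * x
      = (1 - x / elen e) * h (src e) + x / elen e * h (tgt e).
    by field; rewrite gt_eqF.
  have t0 : 0 <= x / elen e by rewrite divr_ge0 // ltW.
  have t1 : x / elen e <= 1 by rewrite ler_pdivrMr // mul1r.
  set t := x / elen e in t0 t1 *.
  have /andP[s1 s2] := h_bnd (src e); have /andP[r1 r2] := h_bnd (tgt e).
  by apply/andP; split; nra.
exists w, wx; split.
- split.
  + exists h; split=> //= e; first by rewrite mulr0 addr0.
      by rewrite slope_len addrC subrK.
    by have [[-> _] _ _ _] := q_prop e.
  + move=> [e|r] x bx.
      split; first by have /andP[? _] := w_edge e x bx; lra.
      by apply: is_derive_eq; rewrite /GRing.scale /=; ring.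
    by have [_ /(_ x bx)[w_ge ?] _ _] := q_prop r; split=> //; apply: le_trans w_ge; exact: ltW.
  + move=> [e|r] x /= bx w1; last first.
      by have [_ _ H _] := q_prop r; apply: H => //; exact: ltW.
    exists 0; first exact: is_derive_cst.
    rewrite add0r ltW // f_neg //.
    have /andP[x0 xe] := bx.
    have /andP[w_lo w_hi] := w_edge e x ltac:(apply/andP; split; lra).
    by apply/andP; split; [apply: lt_le_trans w_lo | apply: le_lt_trans w_hi _]; lra.
  + move=> v; apply: le_lt_trans (h_flux v).
    rewrite /outgoing_flux /outflow /edge_flux; apply: lerD.
      have E e : ethick e / elen e * (h (tgt e) - h (src e)) = ethick e * slope e.
        by rewrite /slope; ring.
      by under eq_bigr do rewrite -E; under [X in _ - X <= _]eq_bigr do rewrite -E.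
    apply: ler_sum => r _; rewrite ler_pM2l ?rthick_gt0 //.
    by have [[_ ?] _ _ _] := q_prop r.
- move=> [e|r] x bx; first by have /andP[? _] := w_edge e x bx; lra.
  by have [_ /(_ x bx)[? _] _ _] := q_prop r.
- by have [_ _ _ [L HL]] := q_prop i; exists L => x /HL; rewrite eqxx.
- move=> j ji; have [_ _ _ [L HL]] := q_prop j.
  by exists L => x /HL; rewrite (negbTE ji).
Qed.

End BistablePotential.

Theorem theorem2p20 (R : realType) (f : R -> R) (a : R) (phi : R -> R) (c : R)
    (Omega : star_graph R) (i : 'I_(npaths Omega)) :
  bistable f a ->
  traveling_wave f a phi c ->
  (2 <= npaths Omega)%N ->
  primitive f 1 + (thickness_ratio i ^+ 2 - 1) * primitive f a < 0 ->
  forall rmin : R, 0 < rmin ->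
  exists2 delta : R, 0 < delta &
  forall (D : bounded_graph R) (P : 'I_(npaths Omega) -> vertex D),
    (forall e : edge D, rmin <= ethick e) ->
    total_length D < delta ->
    forall u v,
      front_like_solution (G := replace_center P) f phi c i u ->
      limit_profile u v ->
      forall j : 'I_(npaths Omega), j != i ->
        propagation_index_is (G := replace_center P) v j 0.
Proof.
move=> f_bi [c0 _ _ phi01 [_ phi0 _]] _ blocking rmin rmin0.
have [[df cf'] /andP[a0 a1] _ _ _] := f_bi.
have cf := bistable_continuous f_bi.
have [F F0 F'] := continuous_antiderivative cf.
have [K K0 fK] := one_sided_lipschitz df cf'.
rewrite !(antiderivative_primitive F' cf) ?F0 ?subr0 ?ltW ?ltr01 // in blocking.
have [th [th0 th_a margin]] := blocking_margin f_bi F' F0 blocking.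
pose A := Num.sqrt (2 * (F 1 + th - F (a - 2 * th))).
pose B := Num.sqrt (2 * (F (2 * th) - F (a - 3 * th))).
pose X (r : 'I_(npaths Omega)) := pthick r * (if r == i then A else - B).
(* Dividing by the thickness of i, this says A < R_i B. *)
have X_sum : \sum_r X r < 0.
  rewrite (bigD1 i) //= /X eqxx.
  rewrite (eq_bigr (fun r => - (pthick r * B))) => [|r /negbTE->]; last by rewrite mulrN.
  rewrite sumrN -big_distrl /= subr_lt0 -ltr_pdivlMl ?pthick_gt0 // mulrA mulrC.
  rewrite (mulrC _^-1) -/(thickness_ratio i).
  have ratio_ge0 : 0 <= thickness_ratio i.
    by rewrite divr_ge0 ?sumr_ge0 // => *; rewrite ltW // pthick_gt0.
  rewrite -[thickness_ratio i]ger0_norm // -sqrtr_sqr mulrC -sqrtrM ?sqr_ge0 //.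
  have FA : F (a - 2 * th) <= F 1.
    have := potential_bounds f_bi F' F0 (s := a - 2 * th) ltac:(apply/andP; split; lra).
    by case/andP.
  rewrite ltr_sqrt; first by lra.
  by apply: lt_trans (_ : 2 * (F 1 + th - F (a - 2 * th)) < _); lra.
pose C := 2 * \sum_r `|X r|.
have C0 : 0 < C.
  have : `|\sum_r X r| <= \sum_r `|X r| by exact: ler_norm_sum.
  by rewrite ltr0_norm // /C; lra.
(* This delta keeps the potential on D within th of a - 2 th. *)
exists (th * rmin / C); first by apply: divr_gt0 => //; exact: mulr_gt0.
move=> D P thick_ge len_lt u v u_front v_lim j ji.
pose G := replace_center P.
have [h [hi h_near h_flux]] :=
  @small_core_potential R G X rmin (a - 2 * th) (P i) rmin0 thick_ge X_sum.
have h_bnd w : a - 3 * th < h w < a - th.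
  have : `|h w - (a - 2 * th)| < th.
    rewrite -(ltr_pM2l rmin0); apply: le_lt_trans (h_near w) _.
    by rewrite -ltr_pdivlMl // mulrC (mulrC rmin).
  by move=> /ltr_normlP[? ?]; apply/andP; split; lra.
have v_small eta : 0 < eta -> eta < th ->
    exists L, forall x, L <= x -> 0 <= v (inr j) x <= 2 * eta.
  move=> eta0 eta_th.
  have [w [wx [w_sup w_ge [L1 w_L1] w_L2]]] :=
    blocking_supersolution f_bi F' F0 (G := G) th_a eta0 eta_th hi h_bnd h_flux.
  have [T [u_off u_on]] := front_like_small L1 u_front c0 phi01 phi0 eta0.
  have [u_sol u01 _] := u_front.
  have uT b x : dom b x -> u T b x <= w b x.
    move=> bx; have [bi|bi] := eqVneq b (inr i); last first.
      by apply: le_trans (w_ge b x bx); exact: u_off.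
    rewrite bi in bx *; have [xL|Lx] := leP x L1.
      by apply: le_trans (w_ge _ _ bx); apply: u_on; rewrite xL andbT.
    by have /andP[_ /ltW u1] := u01 T _ _ bx; apply: le_trans (w_L1 x (ltW Lx)).
  have u_le := comparison K0 fK u_sol u01 w_sup uT.
  have [L w_L] := w_L2 j ji.
  exists (Num.max 0 L) => x; rewrite ge_max => /andP[x0 Lx].
  have jx : dom (inr j : branch G) x by [].
  have u_v := v_lim _ _ jx.
  apply/andP; split.
    apply: (cvgr_to_ge u_v); near=> t.
    by have /andP[/ltW] := u01 t _ _ jx.
  apply: le_trans (w_L x Lx); apply: (cvgr_to_le u_v); near=> t.
  by apply: u_le => //; near: t; apply: nbhs_pinfty_ge; exact: num_real.
apply/cvgrPdist_lt => e e0.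
pose eta := Num.min th e / 4.
have [eta0 [eta_th eta_e]] : 0 < eta /\ eta < th /\ 2 * eta < e.
  by rewrite /eta; case: (leP th e) => ?; split; [lra | split; lra | lra | split; lra].
have [L v_L] := v_small eta eta0 eta_th.
near=> x; have /andP[v0 v1] : 0 <= v (inr j) x <= 2 * eta.
  by apply: v_L; near: x; apply: nbhs_pinfty_ge; exact: num_real.
by rewrite sub0r normrN ger0_norm //; lra.
Unshelve. all: by end_near. Qed.
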